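(* Let $M\ge0$ be real and let $\varphi_0,\varphi_1\in C_0^\infty(\mathbb R)$. The solution $u=u(x,t)$ of the Cauchy problem $$u_{tt}-e^{-2t}u_{xx}+M^2u=0,\qquad u(x,0)=\varphi_0(x),\qquad u_t(x,0)=\varphi_1(x),$$ can be represented, for $t>0$, as $$u(x,t)=\tfrac12e^{\frac t2}\big[\varphi_0(x+1-e^{-t})+\varphi_0(x-1+e^{-t})\big]+\int_0^{1-e^{-t}}\big[\varphi_0(x-z)+\varphi_0(x+z)\big]K_0(z,t)\,dz+\int_0^{1-e^{-t}}\big[\varphi_1(x-z)+\varphi_1(x+z)\big]K_1(z,t)\,dz,$$ where, for $0\le z\le 1-e^{-t}$ and with $\zeta:=\dfrac{(1-e^{-t})^2-z^2}{(1+e^{-t})^2-z^2}$, $$K_0(z,t):=-\Big[\frac{\partial}{\partial b}E(z,t;0,b)\Big]_{b=0}=\frac{(4e^{-t})^{iM}\big((e^{-t}+1)^2-z^2\big)^{-iM}}{[(1-e^{-t})^2-z^2]\sqrt{(e^{-t}+1)^2-z^2}}\Big[\big(e^{-t}-1-iM(e^{-2t}-1-z^2)\big)F\big(\tfrac12+iM,\tfrac12+iM;1;\zeta\big)+\big(1-e^{-2t}+z^2\big)\big(\tfrac12-iM\big)F\big(-\tfrac12+iM,\tfrac12+iM;1;\zeta\big)\Big]$$ and $$K_1(z,t):=E(z,t;0,0)=(4e^{-t})^{iM}\big((1+e^{-t})^2-z^2\big)^{-\frac12-iM}F\big(\tfrac12+iM,\tfrac12+iM;1;\zeta\big).$$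
   Context: $F(a,b;c;\zeta)$ denotes the Gauss hypergeometric function. The function $E$ is $$E(x,t;x_0,t_0)=(4e^{-t_0-t})^{iM}\big((e^{-t}+e^{-t_0})^2-(x-x_0)^2\big)^{-\frac12-iM}F\Big(\tfrac12+iM,\tfrac12+iM;1;\frac{(e^{-t_0}-e^{-t})^2-(x-x_0)^2}{(e^{-t_0}+e^{-t})^2-(x-x_0)^2}\Big).$$ The explicit expression for $K_0$ is understood by continuity at $z=1-e^{-t}$. *)

(* Defs.v *)
From Stdlib Require Import Reals Factorial.
From Coquelicot Require Import Coquelicot.
Open Scope R_scope.

(* Complex power of a positive real base: x ^ a = exp (a * ln x), with the
   principal (real) logarithm.  Only meaningful for 0 < x. *)
Definition rcpow (x : R) (a : C) : C :=
  (exp (Re a * ln x) * cos (Im a * ln x),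
   exp (Re a * ln x) * sin (Im a * ln x)).

Fixpoint rising (a : C) (n : nat) : C :=
  match n with
  | O => 1%C
  | S m => (rising a m * (a + INR m))%C
  end.

Definition hyp_coef (a b c : C) (n : nat) : C :=
  (rising a n * rising b n / (rising c n * INR (fact n)))%C.

(* Gauss hypergeometric function at a real argument, given by its power series
   (hence meaningful for |zeta| < 1); the real and imaginary parts of the
   series are summed separately. *)
Definition hypF (a b c : C) (zeta : R) : C :=
  (PSeries (fun n => Re (hyp_coef a b c n)) zeta,
   PSeries (fun n => Im (hyp_coef a b c n)) zeta).

Definition iM (M : R) : C := (Ci * M)%C.
Definition half : C := RtoC (1 / 2).

Definition E (M x t x0 t0 : R) : C :=
  let D := (exp (- t) + exp (- t0)) ^ 2 - (x - x0) ^ 2 in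
  let N := (exp (- t0) - exp (- t)) ^ 2 - (x - x0) ^ 2 in
  (rcpow (4 * exp (- t0 - t)) (iM M)
   * rcpow D (- half - iM M)
   * hypF (half + iM M) (half + iM M) 1 (N / D))%C.

(* Derivative of a complex-valued function of a real variable. *)
Definition CDerive (f : R -> C) (x : R) : C :=
  (Derive (fun y => Re (f y)) x, Derive (fun y => Im (f y)) x).

Definition K0 (M z t : R) : C := (- CDerive (fun b => E M z t 0 b) 0)%C.
Definition K1 (M z t : R) : C := E M z t 0 0.

Definition zeta (z t : R) : R :=
  ((1 - exp (- t)) ^ 2 - z ^ 2) / ((1 + exp (- t)) ^ 2 - z ^ 2).

(* At z = 1 - exp (- t) the denominator vanishes, and the value of this
   expression there is irrelevant. *)
Definition K0_formula (M z t : R) : C :=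
  (rcpow (4 * exp (- t)) (iM M)
   * rcpow ((exp (- t) + 1) ^ 2 - z ^ 2) (- iM M)
   / RtoC (((1 - exp (- t)) ^ 2 - z ^ 2) * sqrt ((exp (- t) + 1) ^ 2 - z ^ 2))
   * ((RtoC (exp (- t) - 1) - iM M * RtoC (exp (- 2 * t) - 1 - z ^ 2))
        * hypF (half + iM M) (half + iM M) 1 (zeta z t)
      + RtoC (1 - exp (- 2 * t) + z ^ 2) * (half - iM M)
        * hypF (- half + iM M) (half + iM M) 1 (zeta z t)))%C.

Definition K1_formula (M z t : R) : C :=
  (rcpow (4 * exp (- t)) (iM M)
   * rcpow ((1 + exp (- t)) ^ 2 - z ^ 2) (- half - iM M)
   * hypF (half + iM M) (half + iM M) 1 (zeta z t))%C.

(* C_0^oo(R), with complex values. *)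
Definition smooth (f : R -> C) : Prop :=
  forall (n : nat) (x : R),
    ex_derive_n (fun y => Re (f y)) n x /\ ex_derive_n (fun y => Im (f y)) n x.

Definition compactly_supported (f : R -> C) : Prop :=
  exists A : R, forall x : R, A < Rabs x -> f x = 0%C.

Definition test_function (f : R -> C) : Prop :=
  smooth f /\ compactly_supported f.

(* [C1_halfplane g gx gt]: g is C^1 on R x [0, +oo) up to the boundary, with
   partial derivatives gx and gt.  Values of g for t < 0 play no role: the
   derivative in t is taken within [0, +oo), so it is one-sided at t = 0. *)
Definition continuous_halfplane (g : R -> R -> C) : Prop :=
  continuous_on (fun p : R * R => 0 <= snd p) (fun p => g (fst p) (snd p)).

Definition C1_halfplane (g gx gt : R -> R -> C) : Prop :=
  continuous_halfplane g /\ continuous_halfplane gx /\ continuous_halfplane gt /\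
  forall x t : R, 0 <= t ->
    is_derive (V := C_R_NormedModule) (fun y => g y t) x (gx x t) /\
    filterdiff (V := C_R_NormedModule) (fun s => g x s)
      (within (fun s => 0 <= s) (locally t))
      (fun h => scal h (gt x t : C_R_NormedModule)).

(* Classical solution, C^2 on R x [0, +oo), of
   u_tt - exp(-2t) u_xx + M^2 u = 0, u(x,0) = phi0 x, u_t(x,0) = phi1 x. *)
Definition solution (M : R) (phi0 phi1 : R -> C) (u : R -> R -> C) : Prop :=
  exists ux ut uxx uxt utx utt : R -> R -> C,
    C1_halfplane u ux ut /\ C1_halfplane ux uxx uxt /\ C1_halfplane ut utx utt /\
    (forall x t : R, 0 <= t ->
       (utt x t - RtoC (exp (- 2 * t)) * uxx x t + RtoC (M ^ 2) * u x t)%C = 0%C) /\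
    (forall x : R, u x 0 = phi0 x) /\
    (forall x : R, ut x 0 = phi1 x).

Definition integrand (phi : R -> C) (K : R -> R -> C) (x t z : R) : C :=
  ((phi (x - z)%R + phi (x + z)%R) * K z t)%C.

Definition CInt (f : R -> C) (a b : R) : C :=
  RInt (V := C_R_CompleteNormedModule) f a b.

Definition ex_CInt (f : R -> C) (a b : R) : Prop :=
  ex_RInt (V := C_R_NormedModule) f a b.

(* Main.v *)
(** Put [a = 1/2 + i M] and [H w = (1 + w)^(- a) F(a, a; 1; w / (1 + w))].  Since
    [1 - zeta = 4 exp (- t - b) / D], the function [E] is the Riemann function
    [E(z, t; 0, b) = 1/2 exp ((t + b) / 2) H w] with
    [w = (cosh (t - b) - 1) / 2 - z^2 exp (t + b) / 4], and the hypergeometric equation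
    becomes [w (1 + w) H'' + (1 + 2 w) H' + (1/4 + M^2) H = 0], i.e. the wave equation
    for [E].  The imaginary part of [H] solves the same equation with value [0] at [0],
    and the energy [w (1 + w) g'^2 + (1/4 + M^2) g^2] forces it to vanish on [w >= 0].

    Representation: for a solution [u] and [rho s = exp (- s) - exp (- t)], the quantity
    [int_{|z| <= rho s} (u_s E - u E_s) (x + z, s) dz
     + 1/2 exp (- s) exp ((s + t) / 2) (u (x + rho s, s) + u (x - rho s, s))]
    does not depend on [s]; it is the right-hand side of the formula at [s = 0] and
    [u (x, t)] at [s = t].

    Existence: [W f (x, t) = int_{|z| <= 1 - exp (- t)} f (x + z) E(z, t; 0, 0) dz] solves
    the equation with data [(0, f)], and the generator [u_t - x u_x] of the symmetry
    [(x, t) -> (exp (- c) x, t + c)] maps it to a solution with data [(f, - x f')].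

    The formula for [K0] is the contiguity relation
    [(1 - a) F(a - 1, a; 1; x) = x (1 - x) F' + (1 - a - a x) F]. *)

Require Import Defs.
From Stdlib Require Import Reals Lra Factorial.
From Coquelicot Require Import Coquelicot.
Open Scope R_scope.

(** * Calculus in one and two variables *)

(** Since [1 - a] is the conjugate of [a], Pfaff's transformation gives [H w = F(a, 1 - a; 1; - w)],
    which explains why [H] is real; hence one real kernel represents the real and the imaginary part
    of [u] separately, and all the analysis can be real. The series for [F] controls [H] only for
    [w > - 1/2], and solutions live only on [t >= 0], whereas differentiation under the integral
    sign is simplest for functions that are C^2 everywhere. Both are therefore continued past [0] by
    a quadratic Taylor polynomial, and the radial equation is used only for [w >= 0], inside the
    light cone. This continuation is not C^3, which shapes the existence proof: differentiating the
    [K0] integral twice in time would involve [H''']. The symmetry generator avoids this, because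
    the extra time derivative of a known solution is traded, through the wave equation, for
    derivatives that fall on the data. *)

Definition continuous2 (f : R -> R -> R) : Prop :=
  forall x y, continuous (fun p : R * R => f (fst p) (snd p)) (x, y).

Lemma continuous_Rplus {T : UniformSpace} (f g : T -> R) (x : T) :
  continuous f x -> continuous g x -> continuous (fun y => f y + g y) x.
Proof. intros Hf Hg. apply (continuous_plus (V := R_NormedModule) f g x Hf Hg). Qed.

Lemma continuous_Rminus {T : UniformSpace} (f g : T -> R) (x : T) :
  continuous f x -> continuous g x -> continuous (fun y => f y - g y) x.
Proof. intros Hf Hg. apply (continuous_minus (V := R_NormedModule) f g x Hf Hg). Qed.

Lemma continuous_Ropp {T : UniformSpace} (f : T -> R) (x : T) :
  continuous f x -> continuous (fun y => - f y) x.
Proof. intros Hf. apply (continuous_opp (V := R_NormedModule) f x Hf). Qed.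

Lemma continuous_Rmult {T : UniformSpace} (f g : T -> R) (x : T) :
  continuous f x -> continuous g x -> continuous (fun y => f y * g y) x.
Proof. intros Hf Hg. apply (continuous_mult (K := R_AbsRing) f g x Hf Hg). Qed.

Lemma continuous_comp_R {T : UniformSpace} (g : R -> R) (f : T -> R) (x : T) :
  continuous f x -> continuous g (f x) -> continuous (fun y => g (f y)) x.
Proof. intros Hf Hg. apply (continuous_comp f g x Hf Hg). Qed.

Lemma continuous_derive (f : R -> R) (x l : R) : is_derive f x l -> continuous f x.
Proof. intros H. apply (ex_derive_continuous f). now exists l. Qed.

Lemma continuous_exp_comp {T : UniformSpace} (f : T -> R) (x : T) :
  continuous f x -> continuous (fun y => exp (f y)) x.
Proof.
intros Hf. apply (continuous_comp_R exp f x Hf).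
apply (continuous_derive _ _ _ (is_derive_exp _)).
Qed.

Lemma continuous2_comp {T : UniformSpace} (f : R -> R -> R) (g h : T -> R) (x : T) :
  continuous2 f -> continuous g x -> continuous h x -> continuous (fun y => f (g y) (h y)) x.
Proof.
intros Hf Hg Hh. apply (continuous_comp_2 g h f x Hg Hh). apply Hf.
Qed.

Lemma continuous_neg_part (x : R) : continuous (fun y => Rmin y 0) x.
Proof.
apply (continuous_ext (fun y => / 2 * (y - Rabs y))).
- intros y. unfold Rmin, Rabs. destruct (Rle_dec y 0), (Rcase_abs y); lra.
- apply continuous_Rmult; [apply continuous_const|].
  apply continuous_Rminus; [apply continuous_id|].
  apply (continuous_Rabs x).
Qed.

Lemma continuous_pos_part (x : R) : continuous (fun y => Rmax y 0) x.
Proof.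
apply (continuous_ext (fun y => y - Rmin y 0)).
- intros y. unfold Rmin, Rmax. destruct (Rle_dec y 0); lra.
- apply continuous_Rminus; [apply continuous_id | apply continuous_neg_part].
Qed.

Ltac continuous_R := cbn [fst snd]; repeat
  match goal with
  | H : continuous ?f ?x |- continuous ?f ?x => exact H
  | |- continuous (fun _ => ?c) _ => apply continuous_const
  | |- continuous (fun p => p) _ => apply continuous_id
  | |- continuous (fun p => fst p) _ => apply continuous_fst
  | |- continuous (fun p => snd p) _ => apply continuous_snd
  | |- continuous fst _ => apply continuous_fst
  | |- continuous snd _ => apply continuous_snd
  | |- continuous (fun p => @?f p + @?g p) _ => apply (continuous_Rplus f g)
  | |- continuous (fun p => @?f p - @?g p) _ => apply (continuous_Rminus f g)
  | |- continuous (fun p => @?f p * @?g p) _ => apply (continuous_Rmult f g)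
  | |- continuous (fun p => - @?f p) _ => apply (continuous_Ropp f)
  | |- continuous (fun p => exp (@?f p)) _ => apply (continuous_exp_comp f)
  end; cbn beta.

Lemma continuous2_continuity_2d (f : R -> R -> R) x y :
  continuous2 f -> continuity_2d_pt f x y.
Proof. intros H. apply continuity_2d_pt_filterlim. apply H. Qed.

Lemma continuous2_snd (f : R -> R -> R) s : continuous2 f -> forall z, continuous (f s) z.
Proof.
intros H z. apply (continuous2_comp f (fun _ => s) (fun z => z)); auto; continuous_R.
Qed.

Lemma ex_RInt_continuous_R (f : R -> R) a b : (forall z, continuous f z) -> ex_RInt f a b.
Proof. intros H. apply (ex_RInt_continuous (V := R_CompleteNormedModule)). intros; apply H. Qed.

(** Leibniz rule: the lower limit moves with velocity [- drho] and counts negatively, so the two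
    endpoint terms add. The assumptions are global, which makes the local side conditions of the
    theorem on parametric integrals immediate. *)
Lemma is_derive_RInt_symmetric (f fs : R -> R -> R) (rho : R -> R) (s drho : R) :
  (forall t z, is_derive (fun t => f t z) t (fs t z)) ->
  continuous2 f -> continuous2 fs -> is_derive rho s drho ->
  is_derive (fun t => RInt (f t) (- rho t) (rho t)) s
    (RInt (fs s) (- rho s) (rho s) + drho * (f s (rho s) + f s (- rho s))).
Proof.
intros Hd Hf Hfs Hr.
assert (HD : forall u v, Derive (fun z => f z v) u = fs u v)
  by (intros u v; now apply is_derive_unique).
assert (HC : forall u v, continuity_2d_pt (fun u v => Derive (fun z => f z v) u) u v).
{ intros u v. apply (continuity_2d_pt_ext fs); [intros; now rewrite HD|].
  now apply continuous2_continuity_2d. }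
assert (HE : forall t a b, ex_RInt (fun z => f t z) a b).
{ intros t a b. apply ex_RInt_continuous_R. now apply continuous2_snd. }
assert (HP : forall t z, continuity_pt (fun z => f t z) z).
{ intros t z. apply continuity_pt_filterlim. now apply (continuous2_snd f t). }
assert (Hr' : is_derive (fun t => - rho t) s (- drho)) by now apply (is_derive_opp rho).
evar_last.
- apply (is_derive_RInt_param_bound_comp f (fun t => - rho t) rho s (- drho) drho).
  + apply filter_forall. auto.
  + exists (mkposreal 1 Rlt_0_1). apply filter_forall. auto.
  + exists (mkposreal 1 Rlt_0_1). apply filter_forall. auto.
  + assumption.
  + assumption.
  + exists (mkposreal 1 Rlt_0_1). apply filter_forall. intros t z _. eexists; apply Hd.
  + intros; apply HC.
  + exists (mkposreal 1 Rlt_0_1). intros; apply HC.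
  + exists (mkposreal 1 Rlt_0_1). intros; apply HC.
  + apply HP.
  + apply HP.
- rewrite (RInt_ext (fun t => Derive (fun u => f u t) s) (fs s)) by (intros; apply HD).
  ring.
Qed.

(** For [x > 0] this is the ordinary two-sided derivative; only at [x = 0] does the restriction to
    [[0, +oo)] make it one-sided, in the same form as in [C1_halfplane]. *)
Definition right_derive (f : R -> R) (x l : R) : Prop :=
  filterdiff f (within (fun s => 0 <= s) (locally x)) (fun h => scal h l).

Lemma right_derive_interior (f : R -> R) t l :
  0 < t -> right_derive f t l -> is_derive f t l.
Proof.
intros Ht [Hl Hd]. split; [exact Hl|].
intros x Hx.
assert (x = t) as -> by (symmetry; exact (is_filter_lim_locally_unique (K := R_AbsRing) (V := R_NormedModule) _ _ Hx)).
assert (Hf0 : is_filter_lim (within (fun s : R_AbsRing => 0 <= s) (locally t)) (t : R_AbsRing)).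
{ intros P HP. unfold within. apply filter_imp with (2 := HP). auto. }
intros eps. specialize (Hd t Hf0 eps). unfold within in Hd.
assert (Hpos : locally t (fun s : R => 0 <= s)).
{ exists (mkposreal _ Ht). intros y Hy.
  assert (Hs' : Rabs (y - t) < t) by exact Hy. apply Rabs_def2 in Hs'. lra. }
generalize (filter_and _ _ Hd Hpos). apply filter_imp. intros y [Hy1 Hy2]; auto.
Qed.

(* Taylor extension to the left of [0] makes everything below global on [R], so that
   differentiation under the integral sign needs no local side conditions. *)
Lemma is_derive_glue (f f' : R -> R) (q : R) :
  (forall t, 0 <= t -> right_derive f t (f' t)) ->
  forall t, is_derive (fun t => f (Rmax t 0) + f' 0 * Rmin t 0 + q * Rmin t 0 ^ 2 / 2) t
    (f' (Rmax t 0) + q * Rmin t 0).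
Proof.
intros H t.
destruct (total_order_T t 0) as [[Ht | ->] | Ht].
- apply (is_derive_ext_loc (fun t => f 0 + f' 0 * t + q * t ^ 2 / 2)).
  + assert (Hp : 0 < - t) by lra. exists (mkposreal _ Hp). intros y Hy.
    assert (y < 0). { revert Hy. unfold ball; simpl; unfold AbsRing_ball, abs, minus, plus, opp; simpl. intros Hy; apply Rabs_def2 in Hy; lra. }
    rewrite Rmax_right, Rmin_left by lra. reflexivity.
  + rewrite Rmax_right, Rmin_left by lra. auto_derive; [easy | field].
- rewrite Rmax_left, Rmin_left by lra.
  destruct (H 0 (Rle_refl 0)) as [_ H0].
  split; [apply is_linear_scal_l|].
  intros x Hx. assert (x = 0) as -> by (symmetry; exact (is_filter_lim_locally_unique (K := R_AbsRing) (V := R_NormedModule) _ _ Hx)).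
  assert (Hpoly : is_derive (fun t => f 0 + f' 0 * t + q * t ^ 2 / 2) 0 (f' 0)).
  { auto_derive; [easy | field]. }
  destruct Hpoly as [_ Hp]. specialize (Hp 0 (fun P H => H)).
  assert (Hf0 : is_filter_lim (within (fun s : R_AbsRing => 0 <= s) (locally 0)) (0 : R_AbsRing)).
  { intros P HP. unfold within. apply filter_imp with (2 := HP). auto. }
  specialize (H0 0 Hf0).
  intros eps. specialize (Hp eps). specialize (H0 eps).
  unfold within in H0. generalize (filter_and _ _ Hp H0).
  apply filter_imp. intros y [Hy1 Hy2].
  (* [f] and the polynomial have the same value and slope at [0], so the remainder estimate comes
     from [f] on the right and from the polynomial on the left. *)
  destruct (Rle_dec 0 y) as [Hy | Hy].
  + specialize (Hy2 Hy). rewrite (Rmax_left y), (Rmin_right y), (Rmax_left 0), (Rmin_right 0) by lra.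
    replace (f y + f' 0 * 0 + q * 0 ^ 2 / 2) with (f y) by field.
    replace (f 0 + f' 0 * 0 + q * 0 ^ 2 / 2) with (f 0) by field.
    replace (f' 0 + q * 0) with (f' 0) by ring. exact Hy2.
  + rewrite (Rmax_right y), (Rmin_left y), (Rmax_left 0), (Rmin_left 0) by lra.
    replace (f' 0 + q * 0) with (f' 0) by ring. exact Hy1.
- apply (is_derive_ext_loc f).
  + exists (mkposreal _ Ht). intros y Hy.
    assert (0 < y). { revert Hy. unfold ball; simpl; unfold AbsRing_ball, abs, minus, plus, opp; simpl. intros Hy; apply Rabs_def2 in Hy; lra. }
    rewrite Rmax_left, Rmin_right by lra. simpl; field.
  + rewrite Rmax_left, Rmin_right by lra.
    replace (f' t + q * 0) with (f' t) by ring.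
    apply right_derive_interior; [exact Ht | apply H; lra].
Qed.


Lemma is_derive_right_derive (f : R -> R) x l : 0 <= x -> is_derive f x l -> right_derive f x l.
Proof.
intros Hx [Hl H]. split; [exact Hl|]. intros y Hy.
(* Limits along the restricted filter are unique because [0 <= x]: every ball around [x] contains
   the point [x + e / 2] of the half-line. *)
assert (HP : ProperFilter' (within (fun s => 0 <= s) (locally x))).
{ split; [|apply within_filter; apply locally_filter].
  intros [e He]. apply (He (x + e / 2)); destruct e as [e Hpos]; simpl in *; [|lra].
  unfold ball; simpl; unfold AbsRing_ball, abs, minus, plus, opp; simpl.
  rewrite Rabs_right; lra. }
assert (y = x) as ->.
{ apply (is_filter_lim_unique (K := R_AbsRing) (V := R_NormedModule) (FF := HP)); [exact Hy|].
  intros P HP'. unfold within. apply filter_imp with (2 := HP'). auto. }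
intros eps. specialize (H x (fun P HP => HP) eps). unfold within.
apply filter_imp with (2 := H). auto.
Qed.

(* The mean value theorem in [x] reduces joint continuity to continuity in [t]
   and a local bound on the [x]-derivative. *)
Lemma continuous_on_halfplane_of_bounded_derive (g gx : R -> R -> R) :
  (forall x t, is_derive (fun y => g y t) x (gx x t)) ->
  (forall x t, continuous (g x) t) ->
  (forall x0 t0, exists C : R, within (fun s => 0 <= s) (locally t0)
     (fun t => forall x, Rabs (x - x0) <= 1 -> Rabs (gx x t) <= C)) ->
  continuous_on (fun p : R * R => 0 <= snd p) (fun p => g (fst p) (snd p)).
Proof.
intros Hd Hc Hb [x0 t0] _. simpl.
destruct (Hb x0 t0) as [C [d1 Hd1]].
apply (filterlim_locally (F := within (fun p : R * R => 0 <= snd p) (locally (x0, t0)))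
  (fun p : R * R => g (fst p) (snd p))). intros eps.
assert (He2 : 0 < eps / 2) by (destruct eps; simpl; lra).
assert (HC : 0 < Rabs C + 1) by (generalize (Rabs_pos C); lra).
assert (He3 : 0 < Rmin 1 (eps / 2 / (Rabs C + 1))).
{ apply Rmin_pos; [lra|]. now apply Rdiv_lt_0_compat. }
generalize (proj1 (filterlim_locally (g x0) (g x0 t0)) (Hc x0 t0) (mkposreal _ He2)).
intros [d2 Hd2].
assert (Hd0 : 0 < Rmin (Rmin d1 d2) (Rmin 1 (eps / 2 / (Rabs C + 1)))).
{ apply Rmin_pos; [|assumption]. apply Rmin_pos; apply cond_pos. }
exists (mkposreal _ Hd0). intros [x t] [Hx Ht] Hpos. simpl in Hx, Ht, Hpos |- *.
assert (Hx' : Rabs (x - x0) < Rmin (Rmin d1 d2) (Rmin 1 (eps / 2 / (Rabs C + 1)))) by exact Hx.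
assert (Ht' : Rabs (t - t0) < Rmin (Rmin d1 d2) (Rmin 1 (eps / 2 / (Rabs C + 1)))) by exact Ht.
clear Hx Ht.
generalize (Rmin_l (Rmin d1 d2) (Rmin 1 (eps / 2 / (Rabs C + 1)))) (Rmin_r (Rmin d1 d2) (Rmin 1 (eps / 2 / (Rabs C + 1)))).
generalize (Rmin_l d1 d2) (Rmin_r d1 d2) (Rmin_l 1 (eps / 2 / (Rabs C + 1))) (Rmin_r 1 (eps / 2 / (Rabs C + 1))).
intros I1 I2 I3 I4 I5 I6.
assert (B1 : Rabs (g x0 t - g x0 t0) < eps / 2).
{ apply (Hd2 t). change (Rabs (t - t0) < d2). lra. }
assert (B2 : Rabs (g x t - g x0 t) <= C * Rabs (x - x0)).
{ destruct (MVT_gen (fun y => g y t) x0 x (fun y => gx y t)) as [c [Hc1 Hc2]].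
  - intros y _; apply Hd.
  - intros y _. apply continuity_pt_filterlim. apply (continuous_derive _ _ _ (Hd y t)).
  - simpl in Hc2. rewrite Hc2, Rabs_mult. apply Rmult_le_compat_r; [apply Rabs_pos|].
    apply Hd1; [change (Rabs (t - t0) < d1); lra | assumption |].
    revert Hc1. unfold Rmin, Rmax. assert (Hx1 : Rabs (x - x0) < 1) by lra. apply Rabs_def2 in Hx1.
    intros Hc1. apply Rabs_le. destruct (Rle_dec x0 x); lra. }
change (Rabs (g x t - g x0 t0) < eps).
replace (g x t - g x0 t0) with ((g x t - g x0 t) + (g x0 t - g x0 t0)) by ring.
apply Rle_lt_trans with (1 := Rabs_triang _ _).
assert (C * Rabs (x - x0) <= eps / 2); [|lra].
apply Rle_trans with ((Rabs C + 1) * Rabs (x - x0)).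
- apply Rmult_le_compat_r; [apply Rabs_pos | generalize (Rle_abs C); lra].
- apply Rle_trans with ((Rabs C + 1) * (eps / 2 / (Rabs C + 1))).
  + apply Rmult_le_compat_l; lra.
  + right. field. lra.
Qed.

Lemma RInt_symmetric (f : R -> R) (r : R) :
  (forall z, continuous f z) -> RInt f (- r) r = RInt (fun z => f z + f (- z)) 0 r.
Proof.
intros Hf.
assert (Hf' : forall z, continuous (fun z => f (- z)) z).
{ intros z. apply (continuous_comp_R f (fun z => - z)); [|apply Hf]. continuous_R. }
assert (H1 : is_RInt (fun z => f (- z)) 0 r (RInt f (- r) 0)).
{ evar_last.
  - apply (is_RInt_ext (fun y => opp (opp (f (- y))))).
    + intros; apply opp_opp.
    + apply (is_RInt_opp (fun y => opp (f (- y)))).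
      apply (is_RInt_comp_opp f 0 r). rewrite Ropp_0.
      apply (RInt_correct (V := R_CompleteNormedModule)). now apply ex_RInt_continuous_R.
  - rewrite <- (opp_RInt_swap f); [apply opp_opp|]. now apply ex_RInt_continuous_R. }
rewrite <- (RInt_Chasles f (- r) 0 r) by now apply ex_RInt_continuous_R.
rewrite (RInt_plus (V := R_CompleteNormedModule) f (fun z => f (- z))) by now apply ex_RInt_continuous_R.
rewrite (is_RInt_unique _ _ _ _ H1). apply Rplus_comm.
Qed.

(** * The Riemann function *)

(** The equation is Legendre's equation in the variable [1 + 2 * w] with degree [- 1/2 + i M], and
    its solution regular at [0] with value [1] is the conical function of Mehler. It is imposed only
    for [w >= 0], that is, inside the light cone, while smoothness is required on the whole line. *)
Definition radial_profile (M : R) (h h1 h2 : R -> R) : Prop :=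
  (forall w, is_derive h w (h1 w)) /\ (forall w, is_derive h1 w (h2 w)) /\
  (forall w, continuous h2 w) /\ h 0 = 1 /\
  (forall w, 0 <= w ->
     w * (1 + w) * h2 w + (1 + 2 * w) * h1 w + (1 / 4 + M ^ 2) * h w = 0).

(* [N / (4 exp (- s - b))] with [N] the numerator occurring in [E]. *)
Definition warg (b s z : R) : R :=
  (exp (s - b) + exp (b - s) - 2) / 4 - z ^ 2 * exp (s + b) / 4.
Definition warg_s (b s z : R) : R :=
  (exp (s - b) - exp (b - s)) / 4 - z ^ 2 * exp (s + b) / 4.
Definition warg_ss (b s z : R) : R :=
  (exp (s - b) + exp (b - s)) / 4 - z ^ 2 * exp (s + b) / 4.

(** The Riemann function is symmetric in its two times; here [s] is the one that gets differentiated
    and [b] stays fixed. The representation uses [kernel h t0 s] with [s] the time of the data, the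
    existence proof [kernel h 0 t] with [t] the time of observation. *)
Definition kernel (h : R -> R) (b s z : R) : R :=
  / 2 * exp ((s + b) / 2) * h (warg b s z).
Definition kernel_s (h h1 : R -> R) (b s z : R) : R :=
  / 2 * exp ((s + b) / 2) * (h (warg b s z) / 2 + h1 (warg b s z) * warg_s b s z).
Definition kernel_ss (h h1 h2 : R -> R) (b s z : R) : R :=
  / 2 * exp ((s + b) / 2) *
  (h (warg b s z) / 4 + h1 (warg b s z) * (warg_s b s z + warg_ss b s z)
   + h2 (warg b s z) * warg_s b s z ^ 2).
Definition kernel_z (h1 : R -> R) (b s z : R) : R :=
  / 2 * exp ((s + b) / 2) * (h1 (warg b s z) * (- z * exp (s + b) / 2)).
Definition kernel_zz (h1 h2 : R -> R) (b s z : R) : R :=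
  / 2 * exp ((s + b) / 2) *
  (h2 (warg b s z) * (- z * exp (s + b) / 2) ^ 2 - h1 (warg b s z) * exp (s + b) / 2).

Lemma is_derive_comp_R (f g : R -> R) (x l m : R) :
  is_derive f (g x) l -> is_derive g x m -> is_derive (fun y => f (g y)) x (m * l).
Proof. intros Hf Hg. exact (is_derive_comp f g x l m Hf Hg). Qed.

Lemma is_derive_Rmult (f g : R -> R) (x l m : R) :
  is_derive f x l -> is_derive g x m -> is_derive (fun y => f y * g y) x (l * g x + f x * m).
Proof. intros Hf Hg. exact (is_derive_mult f g x l m Hf Hg Rmult_comm). Qed.

Lemma is_derive_Rplus (f g : R -> R) (x l m : R) :
  is_derive f x l -> is_derive g x m -> is_derive (fun y => f y + g y) x (l + m).
Proof. intros Hf Hg. exact (is_derive_plus f g x l m Hf Hg). Qed.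

Lemma is_derive_warg_s b s z : is_derive (fun s => warg b s z) s (warg_s b s z).
Proof. unfold warg, warg_s. auto_derive; [easy|]. unfold Rminus. field. Qed.

Lemma is_derive_warg_z b s z : is_derive (fun z => warg b s z) z (- z * exp (s + b) / 2).
Proof. unfold warg. auto_derive; [easy|]. field. Qed.

Lemma is_derive_kernel_s h h1 b s z :
  is_derive h (warg b s z) (h1 (warg b s z)) ->
  is_derive (fun s => kernel h b s z) s (kernel_s h h1 b s z).
Proof.
intros H. unfold kernel. evar_last.
- apply is_derive_Rmult.
  + apply (is_derive_Rmult (fun _ => / 2)). apply (is_derive_const (/ 2)).
    apply (is_derive_comp_R exp (fun s => (s + b) / 2) s). apply is_derive_exp.
    instantiate (1 := / 2). auto_derive; [easy | field].
  + apply (is_derive_comp_R h); [exact H | apply is_derive_warg_s].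
- unfold kernel_s, zero; simpl. field.
Qed.

Lemma is_derive_kernel_ss h h1 h2 b s z :
  is_derive h (warg b s z) (h1 (warg b s z)) ->
  is_derive h1 (warg b s z) (h2 (warg b s z)) ->
  is_derive (fun s => kernel_s h h1 b s z) s (kernel_ss h h1 h2 b s z).
Proof.
intros H H1. unfold kernel_s. evar_last.
- apply is_derive_Rmult.
  + apply (is_derive_Rmult (fun _ => / 2)). apply (is_derive_const (/ 2)).
    apply (is_derive_comp_R exp (fun s => (s + b) / 2) s). apply is_derive_exp.
    instantiate (1 := / 2). auto_derive; [easy | field].
  + apply is_derive_Rplus.
    * apply is_derive_Rmult; [|apply (is_derive_const (/ 2))].
      apply (is_derive_comp_R h); [exact H | apply is_derive_warg_s].
    * apply is_derive_Rmult.
      -- apply (is_derive_comp_R h1); [exact H1 | apply is_derive_warg_s].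
      -- instantiate (1 := warg_ss b s z). unfold warg_s, warg_ss.
         auto_derive; [easy | unfold Rminus; field].
- unfold kernel_ss, zero; simpl. field.
Qed.

Lemma is_derive_kernel_z h h1 b s z :
  is_derive h (warg b s z) (h1 (warg b s z)) ->
  is_derive (fun z => kernel h b s z) z (kernel_z h1 b s z).
Proof.
intros H. unfold kernel. evar_last.
- apply is_derive_Rmult; [apply is_derive_const|].
  apply (is_derive_comp_R h); [exact H | apply is_derive_warg_z].
- unfold kernel_z, zero; simpl. field.
Qed.

Lemma is_derive_kernel_zz h1 h2 b s z :
  is_derive h1 (warg b s z) (h2 (warg b s z)) ->
  is_derive (fun z => kernel_z h1 b s z) z (kernel_zz h1 h2 b s z).
Proof.
intros H. unfold kernel_z. evar_last.
- apply is_derive_Rmult; [apply is_derive_const|].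
  apply is_derive_Rmult.
  + apply (is_derive_comp_R h1); [exact H | apply is_derive_warg_z].
  + instantiate (1 := - exp (s + b) / 2). auto_derive; [easy | field].
- unfold kernel_zz, zero; simpl. field.
Qed.

Lemma continuous2_warg b : continuous2 (warg b).
Proof. intros s z. unfold warg, Rdiv. simpl. continuous_R. Qed.

Lemma continuous2_warg_s b : continuous2 (warg_s b).
Proof. intros s z. unfold warg_s, Rdiv. simpl. continuous_R. Qed.

Lemma continuous2_warg_ss b : continuous2 (warg_ss b).
Proof. intros s z. unfold warg_ss, Rdiv. simpl. continuous_R. Qed.

Lemma continuous2_fun_warg f b : (forall w, continuous f w) -> continuous2 (fun s z => f (warg b s z)).
Proof.
intros Hf s z. apply (continuous_comp_R f (fun p => warg b (fst p) (snd p))); [|apply Hf].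
apply continuous2_warg.
Qed.

Lemma continuous2_kernel h b : (forall w, continuous h w) -> continuous2 (kernel h b).
Proof.
intros H s z. unfold kernel, Rdiv. continuous_R. now apply (continuous2_fun_warg h).
Qed.

Lemma continuous2_kernel_s h h1 b :
  (forall w, continuous h w) -> (forall w, continuous h1 w) -> continuous2 (kernel_s h h1 b).
Proof.
intros H H1 s z. unfold kernel_s, Rdiv. continuous_R.
- now apply (continuous2_fun_warg h).
- now apply (continuous2_fun_warg h1).
- apply continuous2_warg_s.
Qed.

Lemma continuous2_kernel_ss h h1 h2 b :
  (forall w, continuous h w) -> (forall w, continuous h1 w) -> (forall w, continuous h2 w) ->
  continuous2 (kernel_ss h h1 h2 b).
Proof.
intros H H1 H2 s z. unfold kernel_ss, Rdiv. simpl. continuous_R.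
- now apply (continuous2_fun_warg h).
- now apply (continuous2_fun_warg h1).
- apply continuous2_warg_s.
- apply continuous2_warg_ss.
- now apply (continuous2_fun_warg h2).
- apply continuous2_warg_s.
- apply continuous2_warg_s.
Qed.

Lemma exp_neg_double x : exp (- 2 * x) = / (exp x * exp x).
Proof. rewrite <- exp_plus, <- exp_Ropp. f_equal. ring. Qed.

Lemma warg_alt b s z :
  warg b s z = ((exp (- b) - exp (- s)) ^ 2 - z ^ 2) / (4 * exp (- s - b)).
Proof.
unfold warg. replace (s - b) with (s + - b) by ring. replace (b - s) with (b + - s) by ring.
replace (- s - b) with (- (s + b)) by ring.
rewrite ?exp_Ropp, ?exp_plus, ?exp_Ropp.
generalize (exp_pos s) (exp_pos b). intros; field. lra.
Qed.

(** The hypothesis places [z] in the closed light cone; the absolute value on the right covers both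
    orders of the times [b] and [s]. *)
Lemma warg_nonneg b s z : Rabs z <= Rabs (exp (- b) - exp (- s)) -> 0 <= warg b s z.
Proof.
intros H. rewrite warg_alt. apply Rmult_le_pos.
- apply Rsqr_le_abs_1 in H. unfold Rsqr in H. simpl. lra.
- left. apply Rinv_0_lt_compat. generalize (exp_pos (- s - b)); lra.
Qed.

Lemma warg_char b s z : z ^ 2 = (exp (- s) - exp (- b)) ^ 2 -> warg b s z = 0.
Proof.
intros H. rewrite warg_alt, H. unfold Rdiv. ring.
Qed.

Lemma kernel_wave_equation M h h1 h2 b s z :
  radial_profile M h h1 h2 -> 0 <= warg b s z ->
  kernel_ss h h1 h2 b s z
  = exp (- 2 * s) * kernel_zz h1 h2 b s z - M ^ 2 * kernel h b s z.
Proof.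
intros (_ & _ & _ & _ & HO) Hw. specialize (HO _ Hw).
apply Rminus_diag_uniq.
(* The defect in the wave equation is exactly the prefactor times the left side of the radial
   equation. *)
transitivity (/ 2 * exp ((s + b) / 2) *
  (warg b s z * (1 + warg b s z) * h2 (warg b s z) + (1 + 2 * warg b s z) * h1 (warg b s z)
   + (1 / 4 + M ^ 2) * h (warg b s z))); [|rewrite HO; ring].
unfold kernel_ss, kernel_zz, kernel.
generalize (h (warg b s z)) (h1 (warg b s z)) (h2 (warg b s z)). intros k0 k1 k2.
rewrite exp_neg_double.
unfold warg, warg_s, warg_ss.
generalize (exp ((s + b) / 2)). intros e.
replace (s - b) with (s + - b) by ring. replace (b - s) with (b + - s) by ring.
rewrite ?exp_plus, ?exp_Ropp.
generalize (exp_pos s) (exp_pos b). generalize (exp s) (exp b). intros X Y HX HY.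
field. lra.
Qed.

(* On the light cone [warg = 0] this is the transport equation of the Riemann function. *)
Lemma kernel_transport h h1 b s z sg :
  sg ^ 2 = 1 -> z = sg * (exp (- s) - exp (- b)) ->
  h 0 = 1 ->
  kernel_s h h1 b s z - sg * exp (- s) * kernel_z h1 b s z = / 4 * exp ((s + b) / 2) /\
  kernel h b s z = / 2 * exp ((s + b) / 2).
Proof.
intros Hsg Hz Hh.
assert (Hw : warg b s z = 0). { apply warg_char. rewrite Hz, Rpow_mult_distr, Hsg. ring. }
unfold kernel_s, kernel_z, kernel. rewrite Hw, Hh.
split; [|ring].
(* [warg] is zero along the whole characteristic [z = sg * (exp (- s) - exp (- b))], so its
   derivative in the direction [d/ds - sg * exp (- s) d/dz] vanishes, and with it every term in
   [h1]. *)
assert (warg_s b s z = - sg * exp (- s) * z * exp (s + b) / 2).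
{ unfold warg_s. replace (z ^ 2) with ((exp (- s) - exp (- b)) ^ 2)
    by (rewrite Hz, Rpow_mult_distr, Hsg; ring).
  replace (- sg * exp (- s) * z) with (- exp (- s) * (exp (- s) - exp (- b)))
    by (rewrite Hz; transitivity (- exp (- s) * (exp (- s) - exp (- b)) * sg ^ 2); [rewrite Hsg|]; ring).
  replace (s - b) with (s + - b) by ring. replace (b - s) with (b + - s) by ring.
  rewrite ?exp_plus, ?exp_Ropp.
  generalize (exp_pos s) (exp_pos b). generalize (exp s) (exp b). intros X Y HX HY.
  field. lra. }
rewrite H. field.
Qed.

Lemma kernel_even h b s z : kernel h b s (- z) = kernel h b s z.
Proof. unfold kernel, warg. now replace ((- z) ^ 2) with (z ^ 2) by ring. Qed.

Lemma kernel_s_even h h1 b s z : kernel_s h h1 b s (- z) = kernel_s h h1 b s z.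
Proof. unfold kernel_s, warg, warg_s. now replace ((- z) ^ 2) with (z ^ 2) by ring. Qed.

(** * The conserved quantity *)

Definition continuous_on_halfplane (g : R -> R -> R) : Prop :=
  continuous_on (fun p : R * R => 0 <= snd p) (fun p => g (fst p) (snd p)).

Definition real_solution (M : R) (u ux ut uxx utt : R -> R -> R) : Prop :=
  continuous_on_halfplane u /\ continuous_on_halfplane ux /\ continuous_on_halfplane ut /\
  continuous_on_halfplane uxx /\ continuous_on_halfplane utt /\
  (forall x t, 0 <= t ->
     is_derive (fun y => u y t) x (ux x t) /\ is_derive (fun y => ux y t) x (uxx x t) /\
     right_derive (u x) t (ut x t) /\ right_derive (ut x) t (utt x t) /\
     utt x t = exp (- 2 * t) * uxx x t - M ^ 2 * u x t).

Lemma continuous_comp_halfplane {T : UniformSpace} (g : R -> R -> R) (a b : T -> R) (p : T) :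
  continuous_on_halfplane g -> (forall q, 0 <= b q) -> continuous a p -> continuous b p ->
  continuous (fun q => g (a q) (b q)) p.
Proof.
intros Hg Hb Ha Hb'.
apply (filterlim_comp _ _ _ (fun q => (a q, b q)) (fun q => g (fst q) (snd q)) _
  (within (fun p : R * R => 0 <= snd p) (locally (a p, b p)))).
- intros P [d Hd].
  assert (Hc : filterlim (fun q => (a q, b q)) (locally p) (locally (a p, b p))).
  { apply filterlim_locally. intros eps.
    generalize (proj1 (filterlim_locally a (a p)) Ha eps) (proj1 (filterlim_locally b (b p)) Hb' eps).
    intros H1 H2. generalize (filter_and _ _ H1 H2). apply filter_imp.
    intros q [Hq1 Hq2]; now split. }
  generalize (proj1 (filterlim_locally (fun q => (a q, b q)) (a p, b p)) Hc d).
  unfold filtermap. apply filter_imp. intros q Hq.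
  apply Hd; [exact Hq | apply Hb].
- apply (Hg (a p, b p)). apply Hb.
Qed.

Lemma continuous_halfplane_interior (g : R -> R -> R) x t :
  continuous_on_halfplane g -> 0 < t -> continuous (fun p : R * R => g (fst p) (snd p)) (x, t).
Proof.
intros Hg Ht. apply (continuous_continuous_on (fun p : R * R => 0 <= snd p)); [|exact Hg].
exists (mkposreal _ Ht). intros [y s] [_ Hs]. simpl in Hs |- *.
assert (Hs' : Rabs (s - t) < t) by exact Hs. apply Rabs_def2 in Hs'. lra.
Qed.

(** Total differentiability needs one partial derivative near the point and continuous there, but
    the other one only at the point itself. This allows [u] to be followed along a
    characteristic. *)
Lemma is_derive_along_curve (u : R -> R -> R) (ux : R -> R -> R) (ut : R) (c : R -> R) (s dc : R) :
  locally (c s, s) (fun p => is_derive (fun y => u y (snd p)) (fst p) (ux (fst p) (snd p))) ->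
  is_derive (u (c s)) s ut ->
  continuous (fun p : R * R => ux (fst p) (snd p)) (c s, s) ->
  is_derive c s dc ->
  is_derive (fun s => u (c s) s) s (dc * ux (c s) s + ut).
Proof.
intros Hx Ht Hc Hdc.
assert (Hu := is_derive_filterdiff u (c s) s ux ut Hx Ht Hc).
unfold is_derive.
assert (H := filterdiff_comp'_2 (K := R_AbsRing) (T := R_NormedModule) (U := R_NormedModule) (V := R_NormedModule)
  (W := R_NormedModule) c (fun s => s) u s (fun h => scal h dc) (fun h => h)
  (fun a b => plus (scal a (ux (c s) s)) (scal b ut)) Hdc (filterdiff_id _) Hu).
apply filterdiff_ext_lin with (1 := H).
intros y. unfold plus, scal; simpl; unfold mult; simpl. ring.
Qed.

(** Green's identity: both factors solve the same wave equation, so the mass terms cancel and the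
    integrand is the [z]-derivative of [exp (- 2 * s) * (ux * kernel - u * kernel_z)]. Only the
    endpoints survive. *)
Lemma conserved_derivative M h h1 h2 u ux ut uxx utt (x0 t0 s : R) :
  radial_profile M h h1 h2 -> real_solution M u ux ut uxx utt -> 0 < s < t0 ->
  let rho := exp (- s) - exp (- t0) in
  RInt (fun z => utt (x0 + z) s * kernel h t0 s z - u (x0 + z) s * kernel_ss h h1 h2 t0 s z) (- rho) rho
  = exp (- 2 * s) *
    ((ux (x0 + rho) s * kernel h t0 s rho - u (x0 + rho) s * kernel_z h1 t0 s rho)
     - (ux (x0 - rho) s * kernel h t0 s (- rho) - u (x0 - rho) s * kernel_z h1 t0 s (- rho))).
Proof.
intros Hh Hu Hs rho.
assert (Hh' := Hh). destruct Hh' as (Hh0 & Hh1 & Hh2 & _ & _).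
destruct Hu as (Hu & Hux & Hut & Huxx & Hutt & Hd).
assert (Hrho : 0 <= rho).
{ unfold rho. assert (exp (- t0) < exp (- s)) by (apply exp_increasing; lra). lra. }
assert (Ch0 : forall w, continuous h w) by (intros w; apply (continuous_derive _ _ _ (Hh0 w))).
assert (Ch1 : forall w, continuous h1 w) by (intros w; apply (continuous_derive _ _ _ (Hh1 w))).
apply (is_RInt_unique (V := R_CompleteNormedModule)).
evar_last.
- apply (is_RInt_derive (V := R_CompleteNormedModule) (fun z => exp (- 2 * s) * (ux (x0 + z) s * kernel h t0 s z - u (x0 + z) s * kernel_z h1 t0 s z))).
  + rewrite Rmin_left, Rmax_right by lra. intros z Hz.
    destruct (Hd (x0 + z) s) as (D1 & D2 & _ & _ & HE); [lra|].
    assert (Dx : is_derive (fun z => x0 + z) z 1) by (auto_derive; [easy | ring]).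
    assert (Hw : 0 <= warg t0 s z).
    { apply warg_nonneg. rewrite Rabs_minus_sym, (Rabs_pos_eq (exp (- s) - exp (- t0))) by exact Hrho.
      apply Rabs_le; exact Hz. }
    rewrite HE, (kernel_wave_equation M h h1 h2 t0 s z Hh Hw).
    evar_last.
    * apply is_derive_Rmult; [apply is_derive_const|].
      apply (is_derive_minus (V := R_NormedModule) (fun z => ux (x0 + z) s * kernel h t0 s z)
         (fun z => u (x0 + z) s * kernel_z h1 t0 s z)).
      -- apply is_derive_Rmult; [|apply is_derive_kernel_z, Hh0].
         apply (is_derive_comp_R (fun y => ux y s) (fun z => x0 + z)); [exact D2 | exact Dx].
      -- apply is_derive_Rmult; [|apply is_derive_kernel_zz, Hh1].
         apply (is_derive_comp_R (fun y => u y s) (fun z => x0 + z)); [exact D1 | exact Dx].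
    * unfold zero, minus, plus, opp; simpl. ring.
  + intros z _.
    assert (C : forall g, continuous_on_halfplane g -> continuous (fun z => g (x0 + z) s) z).
    { intros g Hg. apply (continuous_comp_halfplane g (fun z => x0 + z) (fun _ => s)); auto; continuous_R. intros; lra. }
    apply (continuous_Rminus (fun z => utt (x0 + z) s * kernel h t0 s z) (fun z => u (x0 + z) s * kernel_ss h h1 h2 t0 s z)).
    * apply (continuous_Rmult (fun z => utt (x0 + z) s)); [auto|].
      apply (continuous2_snd (kernel h t0)). now apply continuous2_kernel.
    * apply (continuous_Rmult (fun z => u (x0 + z) s)); [auto|].
      apply (continuous2_snd (kernel_ss h h1 h2 t0)). now apply continuous2_kernel_ss.
- unfold minus, plus, opp; simpl. unfold Rminus. ring.
Qed.

Theorem real_representation M h h1 h2 u ux ut uxx utt (x0 t0 : R) :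
  radial_profile M h h1 h2 -> real_solution M u ux ut uxx utt -> 0 < t0 ->
  let r := 1 - exp (- t0) in
  u x0 t0 = / 2 * exp (t0 / 2) * (u (x0 + r) 0 + u (x0 - r) 0)
    + RInt (fun z => ut (x0 + z) 0 * kernel h t0 0 z - u (x0 + z) 0 * kernel_s h h1 t0 0 z) (- r) r.
Proof.
intros Hh Hu Ht0 r.
assert (Hh' := Hh). destruct Hh' as (Hh0 & Hh1 & Hh2 & Hone & _).
assert (Hu' := Hu). destruct Hu' as (Hcu & Hcux & Hcut & Hcuxx & Hcutt & Hd).
assert (Ch0 : forall w, continuous h w) by (intros w; apply (continuous_derive _ _ _ (Hh0 w))).
assert (Ch1 : forall w, continuous h1 w) by (intros w; apply (continuous_derive _ _ _ (Hh1 w))).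
(* Below [s = 0] these are a quadratic, its derivative and its second derivative, so the relations
   between [u], [ut] and [utt] persist for all [s], and the Leibniz rule holds at [s = 0] too. *)
pose (ue := fun s z => u (x0 + z) (Rmax s 0) + ut (x0 + z) 0 * Rmin s 0 + utt (x0 + z) 0 * Rmin s 0 ^ 2 / 2).
pose (ute := fun s z => ut (x0 + z) (Rmax s 0) + utt (x0 + z) 0 * Rmin s 0).
pose (utte := fun s z => utt (x0 + z) (Rmax s 0)).
pose (f := fun s z => ute s z * kernel h t0 s z - ue s z * kernel_s h h1 t0 s z).
pose (fs := fun s z => utte s z * kernel h t0 s z - ue s z * kernel_ss h h1 h2 t0 s z).
pose (rho := fun s => exp (- s) - exp (- t0)).
assert (E0 : forall s z, 0 <= s -> ue s z = u (x0 + z) s).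
{ intros s z Hs. unfold ue. rewrite Rmax_left, Rmin_right by lra. field. }
assert (E1 : forall s z, 0 <= s -> ute s z = ut (x0 + z) s).
{ intros s z Hs. unfold ute. rewrite Rmax_left, Rmin_right by lra. field. }
assert (E2 : forall s z, 0 <= s -> utte s z = utt (x0 + z) s).
{ intros s z Hs. unfold utte. rewrite Rmax_left by lra. reflexivity. }
assert (D0 : forall s z, is_derive (fun s => ue s z) s (ute s z)).
{ intros s z. apply (is_derive_glue (u (x0 + z)) (ut (x0 + z)) (utt (x0 + z) 0)).
  intros t Ht. apply (Hd (x0 + z) t Ht). }
assert (D1 : forall s z, is_derive (fun s => ute s z) s (utte s z)).
{ intros s z. unfold ute, utte.
  apply (is_derive_ext (fun s => ut (x0 + z) (Rmax s 0) + utt (x0 + z) 0 * Rmin s 0 + 0 * Rmin s 0 ^ 2 / 2)).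
  { intros t. simpl. field. }
  evar_last. apply (is_derive_glue (ut (x0 + z)) (utt (x0 + z)) 0).
  - intros t Ht. apply (Hd (x0 + z) t Ht).
  - ring. }
assert (C : forall g, continuous_on_halfplane g -> continuous2 (fun s z => g (x0 + z) (Rmax s 0))).
{ intros g Hg s z. apply (continuous_comp_halfplane g (fun p => x0 + snd p) (fun p => Rmax (fst p) 0)); auto.
  - intros q. apply Rmax_r.
  - continuous_R.
  - apply (continuous_comp_R (fun y => Rmax y 0)); [continuous_R | apply continuous_pos_part]. }
assert (C' : forall g, continuous_on_halfplane g -> continuous2 (fun _ z => g (x0 + z) 0)).
{ intros g Hg s z. apply (continuous_comp_halfplane g (fun p => x0 + snd p) (fun p => 0)); auto.
  - intros; lra.
  - continuous_R.
  - continuous_R. }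
assert (Cm : continuous2 (fun s _ => Rmin s 0)).
{ intros s z. apply (continuous_comp_R (fun y => Rmin y 0)); [continuous_R | apply continuous_neg_part]. }
assert (C0 : continuous2 ue).
{ intros s z. unfold ue, Rdiv. simpl. continuous_R.
  - now apply (C u). - now apply (C' ut). - apply Cm. - now apply (C' utt). - apply Cm. - apply Cm. }
assert (C1 : continuous2 ute).
{ intros s z. unfold ute. continuous_R.
  - now apply (C ut). - now apply (C' utt). - apply Cm. }
assert (C2 : continuous2 utte) by now apply (C utt).
assert (Cf : continuous2 f).
{ intros s z. unfold f. continuous_R.
  - apply C1. - now apply continuous2_kernel.
  - apply C0. - now apply continuous2_kernel_s. }
assert (Cfs : continuous2 fs).
{ intros s z. unfold fs. continuous_R.
  - apply C2. - now apply continuous2_kernel.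
  - apply C0. - now apply continuous2_kernel_ss. }
assert (Df : forall s z, is_derive (fun s => f s z) s (fs s z)).
{ intros s z. unfold f, fs. evar_last.
  - apply (is_derive_minus (V := R_NormedModule) (fun s => ute s z * kernel h t0 s z) (fun s => ue s z * kernel_s h h1 t0 s z)).
    + apply is_derive_Rmult; [apply D1 | apply is_derive_kernel_s, Hh0].
    + apply is_derive_Rmult; [apply D0 | apply is_derive_kernel_ss; [apply Hh0 | apply Hh1]].
  - unfold minus, plus, opp; simpl. ring. }
assert (Drho : forall s, is_derive rho s (- exp (- s))).
{ intros s. unfold rho. auto_derive; [easy | ring]. }
assert (Crho : forall s, continuous rho s) by (intros s; apply (continuous_derive _ _ _ (Drho s))).
pose (F := fun s => RInt (f s) (- rho s) (rho s)).
assert (DF : forall s, is_derive F s (RInt (fs s) (- rho s) (rho s) + - exp (- s) * (f s (rho s) + f s (- rho s)))).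
{ intros s. now apply is_derive_RInt_symmetric. }
(* [eK s] is [exp (- s)] times the value of the kernel on the light cone. With this weight the
   endpoint terms containing [ut] and [ux] cancel in the derivative of [F + B]. *)
pose (eK := fun s => / 2 * exp (- s) * exp ((s + t0) / 2)).
assert (DeK : forall s, is_derive eK s (- / 2 * eK s)).
{ intros s. unfold eK. auto_derive; [easy | unfold Rdiv; field]. }
pose (B := fun s => eK s * (ue s (rho s) + ue s (- rho s))).
(* Mean value theorem: the derivative is zero for [0 < s < t0], where the extensions agree with the
   solution near [s], and continuity of [F + B] reaches both ends. *)
assert (HI : F t0 + B t0 = F 0 + B 0).
{ destruct (MVT_gen (fun s => F s + B s) 0 t0 (fun _ => 0)) as [c [_ Hc]].
  - rewrite Rmin_left, Rmax_right by lra. intros s Hs.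
    assert (Dend : forall sg, is_derive (fun s => ue s (sg * rho s)) s
      (sg * - exp (- s) * ux (x0 + sg * rho s) s + ut (x0 + sg * rho s) s)).
    { intros sg. apply (is_derive_ext_loc (fun s => u (x0 + sg * rho s) s)).
      - exists (mkposreal s (proj1 Hs)). intros y Hy. symmetry; apply E0.
        assert (Hy' : Rabs (y - s) < s) by exact Hy. apply Rabs_def2 in Hy'. lra.
      - apply (is_derive_along_curve u ux (ut (x0 + sg * rho s) s) (fun s => x0 + sg * rho s)).
        + exists (mkposreal s (proj1 Hs)). intros [y t] [_ Hy]. simpl in Hy |- *.
          assert (Hy' : Rabs (t - s) < s) by exact Hy. apply Rabs_def2 in Hy'.
          apply (Hd y t). lra.
        + apply right_derive_interior; [lra|]. apply (Hd (x0 + sg * rho s) s). lra.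
        + apply continuous_halfplane_interior; [assumption | lra].
        + unfold rho. auto_derive; [easy | ring]. }
    evar_last.
    + apply is_derive_Rplus; [apply DF|].
      apply is_derive_Rmult; [apply DeK|].
      apply is_derive_Rplus.
      * apply (is_derive_ext (fun s => ue s (1 * rho s))); [intros; f_equal; ring|]. apply Dend.
      * apply (is_derive_ext (fun s => ue s (-1 * rho s))); [intros; f_equal; ring|]. apply Dend.
    + rewrite (RInt_ext (fs s) (fun z => utt (x0 + z) s * kernel h t0 s z - u (x0 + z) s * kernel_ss h h1 h2 t0 s z)).
      2: { intros z _. unfold fs. rewrite E2, E0 by lra. reflexivity. }
      unfold rho at 1 2. rewrite (conserved_derivative M h h1 h2 u ux ut uxx utt x0 t0 s Hh Hu Hs).
      fold (rho s).
      (* The remaining endpoint terms carry the factor [u]: the transport equation turns [kernel_s]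
         into [kernel_z], which cancels the flux, plus a term balanced by the derivative of [eK]. *)
      destruct (kernel_transport h h1 t0 s (rho s) 1) as [T1 T2]; [ring | unfold rho; ring | exact Hone |].
      destruct (kernel_transport h h1 t0 s (- rho s) (-1)) as [T3 T4]; [ring | unfold rho; ring | exact Hone |].
      unfold f. rewrite !E0, !E1 by lra. rewrite T2, T4.
      replace (x0 + 1 * rho s) with (x0 + rho s) by ring.
      replace (x0 + -1 * rho s) with (x0 - rho s) by ring.
      replace (x0 + - rho s) with (x0 - rho s) by ring.
      assert (T1' : kernel_s h h1 t0 s (rho s) = exp (- s) * kernel_z h1 t0 s (rho s) + / 4 * exp ((s + t0) / 2)) by lra.
      assert (T3' : kernel_s h h1 t0 s (- rho s) = - exp (- s) * kernel_z h1 t0 s (- rho s) + / 4 * exp ((s + t0) / 2)) by lra.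
      rewrite T1', T3'. unfold eK.
      replace (exp (-2 * s)) with (exp (- s) * exp (- s)) by (rewrite <- exp_plus; f_equal; ring).
      field.
  - intros s _. apply continuity_pt_filterlim. apply (continuous_Rplus F B).
    + apply (continuous_derive _ _ _ (DF s)).
    + unfold B. continuous_R.
      * apply (continuous_derive _ _ _ (DeK s)).
      * apply (continuous2_comp ue (fun s => s) rho); auto; continuous_R.
      * apply (continuous2_comp ue (fun s => s) (fun s => - rho s)); auto; continuous_R. apply Crho.
  - simpl in Hc. lra. }
assert (Hr0 : rho 0 = r) by (unfold rho, r; now rewrite Ropp_0, exp_0).
assert (Hrt : rho t0 = 0) by (unfold rho; ring).
unfold F, B in HI. rewrite Hrt, Hr0, Ropp_0, RInt_point in HI.
rewrite !E0 in HI by lra.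
rewrite (RInt_ext (f 0) (fun z => ut (x0 + z) 0 * kernel h t0 0 z - u (x0 + z) 0 * kernel_s h h1 t0 0 z)) in HI.
2: { intros z _. unfold f. rewrite E1, E0 by lra. reflexivity. }
unfold eK in HI. rewrite Ropp_0, exp_0, Rplus_0_r, (Rplus_0_l t0), Rplus_0_l in HI.
replace ((t0 + t0) / 2) with t0 in HI by field.
replace (/ 2 * exp (- t0) * exp t0) with (/ 2) in HI.
2: { rewrite Rmult_assoc, <- exp_plus, Rplus_opp_l, exp_0. ring. }
unfold zero in HI; simpl in HI.
replace (x0 + - r) with (x0 - r) in HI by ring. nra.
Qed.

(** * Construction of solutions *)

(** A smooth function is carried together with all its derivatives, so that differentiating a wave
    integral in [x] is a shift of the index. *)
Definition smooth_seq (f : nat -> R -> R) : Prop :=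
  forall n x, is_derive (f n) x (f (S n) x).

Definition radius (t : R) : R := 1 - exp (- t).

Definition wave (k : R -> R -> R) (f : R -> R) (x t : R) : R :=
  RInt (fun z => f (x + z) * k t z) (- radius t) (radius t).

Lemma is_derive_radius t : is_derive radius t (exp (- t)).
Proof. unfold radius. auto_derive; [easy | ring]. Qed.

Lemma is_derive_shift (f : R -> R) (x z l : R) :
  is_derive f (x + z) l -> is_derive (fun x => f (x + z)) x l.
Proof.
intros H. evar_last. apply (is_derive_comp_R f (fun x => x + z)); [exact H|].
instantiate (1 := 1). auto_derive; [easy | ring]. ring.
Qed.

Lemma is_derive_shift_r (f : R -> R) (x z l : R) :
  is_derive f (x + z) l -> is_derive (fun z => f (x + z)) z l.
Proof.
intros H. evar_last. apply (is_derive_comp_R f (fun z => x + z)); [exact H|].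
instantiate (1 := 1). auto_derive; [easy | ring]. ring.
Qed.

Lemma continuous2_shift_mult (f : R -> R) (k : R -> R -> R) x :
  (forall y, continuous f y) -> continuous2 k -> continuous2 (fun t z => f (x + z) * k t z).
Proof.
intros Hf Hk t z. continuous_R; [|apply Hk].
apply (continuous_comp_R f (fun p : R * R => x + snd p)); [continuous_R | apply Hf].
Qed.

Lemma is_derive_wave_x k (f f' : R -> R) x t :
  (forall y, is_derive f y (f' y)) -> (forall y, continuous f' y) -> continuous2 k ->
  is_derive (fun x => wave k f x t) x (wave k f' x t).
Proof.
intros Hf Hf' Hk.
assert (C : forall g, (forall y, continuous g y) -> continuous2 (fun x z => g (x + z) * k t z)).
{ intros g Hg y z.
  apply (continuous_Rmult (fun p : R * R => g (fst p + snd p)) (fun p => k t (snd p))).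
  - apply (continuous_comp_R g (fun p : R * R => fst p + snd p)); [continuous_R | apply Hg].
  - apply (continuous2_comp k (fun _ => t) snd); [exact Hk | continuous_R | continuous_R]. }
evar_last.
- apply (is_derive_RInt_symmetric (fun x z => f (x + z) * k t z) (fun x z => f' (x + z) * k t z)
    (fun _ => radius t) x 0).
  + intros y z. evar_last. apply is_derive_Rmult; [apply is_derive_shift, Hf | apply is_derive_const].
    unfold zero; simpl. ring.
  + apply C. intros y; apply (continuous_derive _ _ _ (Hf y)).
  + now apply C.
  + apply (is_derive_const (radius t)).
- unfold wave. ring.
Qed.

Lemma is_derive_wave_t k k' (f : R -> R) x t :
  (forall y, continuous f y) -> continuous2 k -> continuous2 k' ->
  (forall t z, is_derive (fun t => k t z) t (k' t z)) ->
  is_derive (fun t => wave k f x t) t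
    (wave k' f x t
     + exp (- t) * (f (x + radius t) * k t (radius t) + f (x - radius t) * k t (- radius t))).
Proof.
intros Hf Hk Hk' Hd.
apply (is_derive_RInt_symmetric (fun t z => f (x + z) * k t z) (fun t z => f (x + z) * k' t z)).
- intros s z. evar_last. apply is_derive_Rmult; [apply is_derive_const | apply Hd].
  unfold zero; simpl. ring.
- now apply continuous2_shift_mult.
- now apply continuous2_shift_mult.
- apply is_derive_radius.
Qed.

Lemma continuous_bounded_segment (f : R -> R) a b :
  a <= b -> (forall x, continuous f x) -> exists B, forall x, a <= x <= b -> Rabs (f x) <= B.
Proof.
intros Hab Hf.
destruct (continuity_ab_maj (fun x => Rabs (f x)) a b Hab) as [m [Hm _]].
- intros c _. apply continuity_pt_filterlim.
  apply (continuous_comp_R Rabs f); [apply Hf | apply (continuous_Rabs (f c))].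
- now exists (Rabs (f m)).
Qed.

Lemma wave_continuous k k' (f f' : R -> R) :
  (forall y, is_derive f y (f' y)) -> (forall y, continuous f' y) ->
  continuous2 k -> continuous2 k' ->
  (forall t z, is_derive (fun t => k t z) t (k' t z)) ->
  continuous_on_halfplane (wave k f).
Proof.
intros Hf Hf' Hk Hk' Hd.
assert (Cf : forall y, continuous f y) by (intros y; apply (continuous_derive _ _ _ (Hf y))).
apply (continuous_on_halfplane_of_bounded_derive (wave k f) (wave k f')).
- intros x t. now apply is_derive_wave_x.
- intros x t. apply (continuous_derive _ _ _ (is_derive_wave_t k k' f x t Cf Hk Hk' Hd)).
- intros x0 t0.
  destruct (continuous_bounded_segment f' (x0 - 2) (x0 + 2)) as [B HB]; [lra | exact Hf' |].
  (* Since [|k| <= 1 + k^2], the integral [m] dominates that of [|k|], and unlike the latter it is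
     differentiable in [t] by the Leibniz rule. The window of radius [2] for [f'] suffices because
     [|x - x0| <= 1] and [|z| < 1]. *)
  pose (m := fun t => RInt (fun z => 1 + k t z * k t z) (- radius t) (radius t)).
  assert (Cm2 : continuous2 (fun t z => 1 + k t z * k t z)).
  { intros t z. continuous_R; apply Hk. }
  assert (Cm : continuous m t0).
  { eapply continuous_derive.
    apply (is_derive_RInt_symmetric (fun t z => 1 + k t z * k t z) (fun t z => 2 * k t z * k' t z)).
    - intros t z. evar_last.
      + apply (is_derive_Rplus (fun _ => 1)); [apply (is_derive_const 1)|].
        apply is_derive_Rmult; apply Hd.
      + unfold zero; simpl. ring.
    - exact Cm2.
    - intros t z. continuous_R; [apply Hk | apply Hk'].
    - apply is_derive_radius. }
  exists (B * (m t0 + 1)).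
  generalize (proj1 (filterlim_locally m (m t0)) Cm (mkposreal 1 Rlt_0_1)).
  unfold within. apply filter_imp. intros t Ht Hpos x Hx.
  assert (Ht' : Rabs (m t - m t0) < 1) by exact Ht. apply Rabs_def2 in Ht'.
  assert (Hr : 0 <= radius t < 1).
  { unfold radius. generalize (exp_pos (- t)). assert (exp (- t) <= 1); [|lra].
    rewrite <- exp_0. destruct (Rle_lt_or_eq_dec 0 t Hpos) as [Hp | <-].
    - left; apply exp_increasing; lra.
    - right; f_equal; ring. }
  apply Rabs_le_between' in Hx.
  assert (B0 : 0 <= B) by (apply Rle_trans with (2 := HB x0 ltac:(lra)), Rabs_pos).
  apply Rle_trans with (B * m t); [|apply Rmult_le_compat_l; lra].
  apply (norm_RInt_le (V := R_NormedModule) (fun z => f' (x + z) * k t z) (fun z => B * (1 + k t z * k t z)) (- radius t) (radius t)).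
  + lra.
  + intros z Hz. change (Rabs (f' (x + z) * k t z) <= B * (1 + k t z * k t z)).
    rewrite Rabs_mult. apply Rmult_le_compat; try apply Rabs_pos.
    * apply HB. lra.
    * apply Rabs_le. nra.
  + apply (RInt_correct (V := R_CompleteNormedModule)). apply ex_RInt_continuous_R.
    apply (continuous2_snd (fun t z => f' (x + z) * k t z)). now apply continuous2_shift_mult.
  + apply (is_RInt_scal (V := R_NormedModule) (fun z => 1 + k t z * k t z) (- radius t) (radius t) B (m t)).
    apply (RInt_correct (V := R_CompleteNormedModule)). apply ex_RInt_continuous_R.
    now apply (continuous2_snd (fun t z => 1 + k t z * k t z)).
Qed.

Lemma wave_zero k f x : wave k f x 0 = 0.
Proof.
unfold wave, radius. rewrite Ropp_0, exp_0, Rminus_diag, Ropp_0. apply (RInt_point (V := R_CompleteNormedModule)).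
Qed.

Definition wave_t (h h1 : R -> R) (f : R -> R) (x t : R) : R :=
  / 2 * exp (- t) * exp (t / 2) * (f (x + radius t) + f (x - radius t)) + wave (kernel_s h h1 0) f x t.

Lemma is_derive_wave_kernel M h h1 h2 f x t :
  radial_profile M h h1 h2 -> (forall y, continuous f y) ->
  is_derive (fun t => wave (kernel h 0) f x t) t (wave_t h h1 f x t).
Proof.
intros (Hh0 & Hh1 & Hh2 & Hone & _) Hf.
evar_last.
- apply (is_derive_wave_t (kernel h 0) (kernel_s h h1 0)); [exact Hf | | |].
  + apply continuous2_kernel. intros w; apply (continuous_derive _ _ _ (Hh0 w)).
  + apply continuous2_kernel_s; intros w; [apply (continuous_derive _ _ _ (Hh0 w)) | apply (continuous_derive _ _ _ (Hh1 w))].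
  + intros; apply is_derive_kernel_s, Hh0.
- unfold wave_t.
  (* With [b = 0] one has [radius t = - (exp (- t) - exp (- b))], so the right endpoint carries the
     sign [-1] here and the left one [1]. *)
  destruct (kernel_transport h h1 0 t (radius t) (-1)) as [_ ->]; [ring | unfold radius; rewrite Ropp_0, exp_0; ring | exact Hone |].
  destruct (kernel_transport h h1 0 t (- radius t) 1) as [_ ->]; [ring | unfold radius; rewrite Ropp_0, exp_0; ring | exact Hone |].
  rewrite Rplus_0_r. ring.
Qed.

(** Two integrations by parts move [d^2/dz^2] from the kernel to [f]. The endpoint terms in [f1]
    cancel against the derivative of the explicit endpoint part of [wave_t], those in [f] by the
    transport equation. *)
Lemma is_derive_wave_t_kernel M h h1 h2 f f1 f2 x t :
  radial_profile M h h1 h2 ->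
  (forall y, is_derive f y (f1 y)) -> (forall y, is_derive f1 y (f2 y)) -> (forall y, continuous f2 y) ->
  is_derive (fun t => wave_t h h1 f x t) t
    (exp (- 2 * t) * wave (kernel h 0) f2 x t - M ^ 2 * wave (kernel h 0) f x t).
Proof.
intros Hh Df Df1 Cf2.
assert (Hh' := Hh). destruct Hh' as (Hh0 & Hh1 & Hh2 & Hone & _).
assert (Ch0 : forall w, continuous h w) by (intros w; apply (continuous_derive _ _ _ (Hh0 w))).
assert (Ch1 : forall w, continuous h1 w) by (intros w; apply (continuous_derive _ _ _ (Hh1 w))).
assert (Cf : forall y, continuous f y) by (intros y; apply (continuous_derive _ _ _ (Df y))).
assert (HI : wave (kernel_ss h h1 h2 0) f x t
  = exp (- 2 * t) * wave (kernel h 0) f2 x t - M ^ 2 * wave (kernel h 0) f x t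
    + exp (- 2 * t) * ((f (x + radius t) * kernel_z h1 0 t (radius t) - f1 (x + radius t) * kernel h 0 t (radius t))
      - (f (x - radius t) * kernel_z h1 0 t (- radius t) - f1 (x - radius t) * kernel h 0 t (- radius t)))).
{ unfold wave.
  assert (X : forall g k, (forall y, continuous g y) -> continuous2 k -> forall t a b, ex_RInt (fun z => g (x + z) * k t z) a b).
  { intros g k Hg Hk s a b. apply ex_RInt_continuous_R.
    apply (continuous2_snd (fun t z => g (x + z) * k t z)). now apply continuous2_shift_mult. }
  assert (Ck := continuous2_kernel h 0 Ch0).
  assert (Ckss := continuous2_kernel_ss h h1 h2 0 Ch0 Ch1 Hh2).
  set (r := radius t).
  apply Rplus_eq_reg_r with (M ^ 2 * RInt (fun z => f (x + z) * kernel h 0 t z) (- r) r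
     - exp (-2 * t) * RInt (fun z => f2 (x + z) * kernel h 0 t z) (- r) r).
  match goal with |- _ = ?rhs => replace rhs with (exp (- 2 * t) * ((f (x + r) * kernel_z h1 0 t r - f1 (x + r) * kernel h 0 t r)
      - (f (x - r) * kernel_z h1 0 t (- r) - f1 (x - r) * kernel h 0 t (- r)))) by ring end.
  assert (HA : is_RInt (fun z => f (x + z) * kernel_ss h h1 h2 0 t z
     + (M ^ 2 * (f (x + z) * kernel h 0 t z) - exp (-2 * t) * (f2 (x + z) * kernel h 0 t z))) (- r) r
     (RInt (fun z => f (x + z) * kernel_ss h h1 h2 0 t z) (- r) r
      + (M ^ 2 * RInt (fun z => f (x + z) * kernel h 0 t z) (- r) r
         - exp (-2 * t) * RInt (fun z => f2 (x + z) * kernel h 0 t z) (- r) r))).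
  { apply (is_RInt_plus (V := R_NormedModule)).
    - apply (RInt_correct (V := R_CompleteNormedModule)). now apply X.
    - apply (is_RInt_minus (V := R_NormedModule)); apply (is_RInt_scal (V := R_NormedModule));
      apply (RInt_correct (V := R_CompleteNormedModule)); now apply X. }
  rewrite <- (is_RInt_unique (V := R_CompleteNormedModule) _ _ _ _ HA).
  apply (is_RInt_unique (V := R_CompleteNormedModule)).
  evar_last.
  - apply (is_RInt_derive (V := R_CompleteNormedModule)
      (fun z => exp (- 2 * t) * (f (x + z) * kernel_z h1 0 t z - f1 (x + z) * kernel h 0 t z))).
    + intros z Hz.
      assert (Hw : 0 <= warg 0 t z).
      { apply warg_nonneg. replace (exp (- 0) - exp (- t)) with r by (unfold r, radius; now rewrite Ropp_0, exp_0).
        (* [t] is arbitrary here, so [r] may be negative and the interval reversed. *)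
        revert Hz. unfold Rmin, Rmax. destruct (Rle_dec (- r) r); intros Hz.
        - rewrite (Rabs_pos_eq r) by lra. apply Rabs_le; lra.
        - rewrite (Rabs_left1 r) by lra. apply Rabs_le; lra. }
      rewrite (kernel_wave_equation M h h1 h2 0 t z Hh Hw).
      evar_last.
      * apply is_derive_Rmult; [apply is_derive_const|].
        apply (is_derive_minus (V := R_NormedModule) (fun z => f (x + z) * kernel_z h1 0 t z) (fun z => f1 (x + z) * kernel h 0 t z)).
        -- apply is_derive_Rmult; [apply is_derive_shift_r, Df | apply is_derive_kernel_zz, Hh1].
        -- apply is_derive_Rmult; [apply is_derive_shift_r, Df1 | apply is_derive_kernel_z, Hh0].
      * unfold zero, minus, plus, opp; simpl. ring.
    + intros z _.
      assert (X' : forall g k, (forall y, continuous g y) -> continuous2 k -> continuous (fun z => g (x + z) * k t z) z).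
      { intros g k Hg Hk. apply (continuous2_snd (fun t z => g (x + z) * k t z)). now apply continuous2_shift_mult. }
      continuous_R.
      * apply (continuous_comp_R f (fun z => x + z)); [continuous_R | apply Cf].
      * apply (continuous2_snd _ t Ckss).
      * apply (continuous_comp_R f (fun z => x + z)); [continuous_R | apply Cf].
      * apply (continuous2_snd _ t Ck).
      * apply (continuous_comp_R f2 (fun z => x + z)); [continuous_R | apply Cf2].
      * apply (continuous2_snd _ t Ck).
  - unfold minus, plus, opp; simpl. unfold Rminus. ring. }
unfold wave_t.
assert (Dend : forall sg, is_derive (fun t => f (x + sg * radius t)) t (sg * exp (- t) * f1 (x + sg * radius t))).
{ intros sg. apply (is_derive_comp_R f (fun t => x + sg * radius t)); [apply Df|].
  unfold radius. auto_derive; [easy | ring]. }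
evar_last.
- apply is_derive_Rplus.
  + apply is_derive_Rmult.
    * instantiate (1 := - / 2 * (/ 2 * exp (- t) * exp (t / 2))). auto_derive; [easy | unfold Rdiv; field].
    * apply is_derive_Rplus.
      -- apply (is_derive_ext (fun t => f (x + 1 * radius t))); [intros; f_equal; ring | apply Dend].
      -- apply (is_derive_ext (fun t => f (x + -1 * radius t))); [intros; f_equal; ring | apply Dend].
  + apply (is_derive_wave_t (kernel_s h h1 0) (kernel_ss h h1 h2 0)); [exact Cf | | |].
    * now apply continuous2_kernel_s.
    * now apply continuous2_kernel_ss.
    * intros; apply is_derive_kernel_ss; [apply Hh0 | apply Hh1].
- rewrite HI.
  replace (x + 1 * radius t) with (x + radius t) by ring.
  replace (x + -1 * radius t) with (x - radius t) by ring.
  destruct (kernel_transport h h1 0 t (radius t) (-1)) as [T1 T2]; [ring | unfold radius; rewrite Ropp_0, exp_0; ring | exact Hone |].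
  destruct (kernel_transport h h1 0 t (- radius t) 1) as [T3 T4]; [ring | unfold radius; rewrite Ropp_0, exp_0; ring | exact Hone |].
  rewrite T2, T4. rewrite Rplus_0_r in T1, T3. rewrite Rplus_0_r.
  assert (T1' : kernel_s h h1 0 t (radius t) = / 4 * exp (t / 2) - exp (- t) * kernel_z h1 0 t (radius t)) by lra.
  assert (T3' : kernel_s h h1 0 t (- radius t) = / 4 * exp (t / 2) + exp (- t) * kernel_z h1 0 t (- radius t)) by lra.
  rewrite T1', T3'.
  replace (exp (-2 * t)) with (exp (- t) * exp (- t)) by (rewrite <- exp_plus; f_equal; ring).
  field.
Qed.

Lemma continuous_on_halfplane_extend (g : R -> R -> R) :
  continuous2 (fun x t => g x (Rmax t 0)) -> continuous_on_halfplane g.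
Proof.
intros H. apply (continuous_on_ext (fun p : R * R => 0 <= snd p) (fun p : R * R => g (fst p) (Rmax (snd p) 0))).
- intros [x t] Ht. simpl in Ht |- *. now rewrite Rmax_left.
- apply continuous_on_forall. intros [x t] _. apply (H x t).
Qed.

Lemma continuous_extend_halfplane (g : R -> R -> R) :
  continuous_on_halfplane g -> continuous2 (fun x t => g x (Rmax t 0)).
Proof.
intros Hg x t. apply (continuous_comp_halfplane g fst (fun p : R * R => Rmax (snd p) 0)); auto.
- intros q. apply Rmax_r.
- continuous_R.
- apply (continuous_comp_R (fun y => Rmax y 0)); [continuous_R | apply continuous_pos_part].
Qed.

Lemma continuous_on_halfplane_plus f g :
  continuous_on_halfplane f -> continuous_on_halfplane g ->
  continuous_on_halfplane (fun x t => f x t + g x t).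
Proof.
intros Hf Hg. apply continuous_on_halfplane_extend. intros x t.
apply continuous_extend_halfplane in Hf, Hg.
apply (continuous_Rplus (fun p => f (fst p) (Rmax (snd p) 0)) (fun p => g (fst p) (Rmax (snd p) 0)));
  [apply Hf | apply Hg].
Qed.

Lemma continuous_on_halfplane_mult f g :
  continuous_on_halfplane f -> continuous_on_halfplane g ->
  continuous_on_halfplane (fun x t => f x t * g x t).
Proof.
intros Hf Hg. apply continuous_on_halfplane_extend. intros x t.
apply continuous_extend_halfplane in Hf, Hg.
apply (continuous_Rmult (fun p => f (fst p) (Rmax (snd p) 0)) (fun p => g (fst p) (Rmax (snd p) 0)));
  [apply Hf | apply Hg].
Qed.

Lemma continuous_on_halfplane_minus f g :
  continuous_on_halfplane f -> continuous_on_halfplane g ->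
  continuous_on_halfplane (fun x t => f x t - g x t).
Proof.
intros Hf Hg. apply continuous_on_halfplane_extend. intros x t.
apply continuous_extend_halfplane in Hf, Hg.
apply (continuous_Rminus (fun p => f (fst p) (Rmax (snd p) 0)) (fun p => g (fst p) (Rmax (snd p) 0)));
  [apply Hf | apply Hg].
Qed.

Lemma continuous_on_halfplane_continuous2 f : continuous2 f -> continuous_on_halfplane f.
Proof. intros Hf. apply continuous_on_forall. intros [x t] _. apply Hf. Qed.

Ltac continuous_on_halfplane_tac := repeat
  match goal with
  | |- continuous_on_halfplane (fun x t => @?f x t + @?g x t) => apply (continuous_on_halfplane_plus f g)
  | |- continuous_on_halfplane (fun x t => @?f x t - @?g x t) => apply (continuous_on_halfplane_minus f g)
  | |- continuous_on_halfplane (fun x t => @?f x t * @?g x t) => apply (continuous_on_halfplane_mult f g)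
  end; cbn beta.

(* The time translation [u_t - x u_x] maps solutions with data [(0, f)] to solutions
   with data [(f, - x f')]; the last term of [g] below corrects the velocity. *)
Lemma real_existence M h h1 h2 (f g : nat -> R -> R) :
  radial_profile M h h1 h2 -> smooth_seq f -> smooth_seq g ->
  exists u ux ut uxx uxt utt,
    real_solution M u ux ut uxx utt /\ continuous_on_halfplane uxt /\
    (forall x t, 0 <= t -> right_derive (ux x) t (uxt x t) /\
       is_derive (fun y => ut y t) x (uxt x t)) /\
    (forall x, u x 0 = f O x) /\ (forall x, ut x 0 = g O x).
Proof.
intros Hh Hf Hg.
assert (Hh' := Hh). destruct Hh' as (Hh0 & Hh1 & Hh2 & Hone & _).
assert (Ch0 : forall w, continuous h w) by (intros w; apply (continuous_derive _ _ _ (Hh0 w))).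
assert (Ch1 : forall w, continuous h1 w) by (intros w; apply (continuous_derive _ _ _ (Hh1 w))).
assert (Ck := continuous2_kernel h 0 Ch0).
assert (Cks := continuous2_kernel_s h h1 0 Ch0 Ch1).
assert (Ckss := continuous2_kernel_ss h h1 h2 0 Ch0 Ch1 Hh2).
assert (Cseq : forall p n, smooth_seq p -> forall y, continuous (p n) y).
{ intros p n Hp y. apply (continuous_derive _ _ _ (Hp n y)). }
(* [W p n] is the [n]-th [x]-derivative of the solution with data [(0, p)], and [V p n] is its time
   derivative. *)
pose (W := fun (p : nat -> R -> R) n => wave (kernel h 0) (p n)).
pose (V := fun (p : nat -> R -> R) n => wave_t h h1 (p n)).
assert (Wx : forall p n x t, smooth_seq p -> is_derive (fun x => W p n x t) x (W p (S n) x t)).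
{ intros p n x t Hp. apply is_derive_wave_x; [apply Hp | now apply Cseq | exact Ck]. }
assert (Wt : forall p n x t, smooth_seq p -> is_derive (W p n x) t (V p n x t)).
{ intros p n x t Hp. apply (is_derive_wave_kernel M h h1 h2); [exact Hh | now apply Cseq]. }
assert (Vx : forall p n x t, smooth_seq p -> is_derive (fun x => V p n x t) x (V p (S n) x t)).
{ intros p n x t Hp. unfold V, wave_t. apply is_derive_Rplus.
  - evar_last. apply is_derive_Rmult; [apply is_derive_const|].
    + apply is_derive_Rplus; apply is_derive_shift; apply Hp.
    + unfold zero; simpl; unfold Rminus; ring.
  - apply is_derive_wave_x; [apply Hp | now apply Cseq | exact Cks]. }
assert (Vt : forall p n x t, smooth_seq p -> is_derive (V p n x) t (exp (- 2 * t) * W p (S (S n)) x t - M ^ 2 * W p n x t)).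
{ intros p n x t Hp. apply (is_derive_wave_t_kernel M h h1 h2 (p n) (p (S n))); auto; apply Hp. }
assert (CW : forall p n, smooth_seq p -> continuous_on_halfplane (W p n)).
{ intros p n Hp. apply (wave_continuous (kernel h 0) (kernel_s h h1 0) (p n) (p (S n))); auto.
  intros; now apply is_derive_kernel_s. }
assert (CV : forall p n, smooth_seq p -> continuous_on_halfplane (V p n)).
{ intros p n Hp. unfold V, wave_t. apply continuous_on_halfplane_plus.
  - apply continuous_on_halfplane_continuous2. intros x t. unfold radius, Rdiv. continuous_R.
    + apply (continuous_comp_R (p n) (fun q : R * R => fst q + (1 - exp (- snd q)))); [continuous_R | now apply Cseq].
    + apply (continuous_comp_R (p n) (fun q : R * R => fst q - (1 - exp (- snd q)))); [continuous_R | now apply Cseq].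
  - apply (wave_continuous (kernel_s h h1 0) (kernel_ss h h1 h2 0) (p n) (p (S n))); auto.
    intros; now apply is_derive_kernel_ss. }
assert (Cx : continuous_on_halfplane (fun x _ => x)).
{ apply continuous_on_halfplane_continuous2. intros x t. continuous_R. }
assert (Ce : continuous_on_halfplane (fun _ t => exp (- 2 * t))).
{ apply continuous_on_halfplane_continuous2. intros x t. continuous_R. }
assert (Cc : forall c, continuous_on_halfplane (fun _ _ => c)).
{ intros c. apply continuous_on_halfplane_continuous2. intros x t. continuous_R. }
(* [k n] is the [n]-th derivative of [g + x f']; the term [INR n * f n] comes from the product rule.
   At time [0] the summand [x f'] compensates the velocity [- x f'] produced by the generator. *)
pose (k := fun n x => g n x + (x * f (S n) x + INR n * f n x)).
assert (Hk : smooth_seq k).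
{ intros n x. unfold k. evar_last.
  - apply is_derive_Rplus; [apply Hg|]. apply is_derive_Rplus.
    + apply is_derive_Rmult; [apply is_derive_id | apply Hf].
    + apply is_derive_Rmult; [apply is_derive_const | apply Hf].
  - rewrite S_INR. unfold zero, one; simpl. ring. }
assert (Did : forall x, is_derive (fun y : R => y) x 1) by (intros x; exact (is_derive_id (K := R_AbsRing) x)).
assert (Dc : forall c x, is_derive (fun y : R => c) x 0) by (intros c x; apply (is_derive_const c)).
assert (De : forall t, is_derive (fun t => exp (- 2 * t)) t (- 2 * exp (- 2 * t))).
{ intros t. auto_derive; [easy | ring]. }
(* The solution is the wave with data [(0, k)] plus [d/dt - x d/dx] applied to the wave with data
   [(0, f)]. In the time derivatives below, that of [V] is already replaced by its value from the
   wave equation. *)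
exists (fun x t => W k O x t + V f O x t - x * W f 1%nat x t).
exists (fun x t => W k 1%nat x t + V f 1%nat x t - (1 * W f 1%nat x t + x * W f 2%nat x t)).
exists (fun x t => V k O x t + (exp (- 2 * t) * W f 2%nat x t - M ^ 2 * W f O x t) - x * V f 1%nat x t).
exists (fun x t => W k 2%nat x t + V f 2%nat x t
  - (1 * W f 2%nat x t + (1 * W f 2%nat x t + x * W f 3%nat x t))).
exists (fun x t => V k 1%nat x t + (exp (- 2 * t) * W f 3%nat x t - M ^ 2 * W f 1%nat x t)
  - (1 * V f 1%nat x t + x * V f 2%nat x t)).
exists (fun x t => (exp (- 2 * t) * W k 2%nat x t - M ^ 2 * W k O x t)
  + ((- 2 * exp (- 2 * t) * W f 2%nat x t + exp (- 2 * t) * V f 2%nat x t) - M ^ 2 * V f O x t)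
  - x * (exp (- 2 * t) * W f 3%nat x t - M ^ 2 * W f 1%nat x t)).
assert (Dm : forall (a b : R -> R) y la lb, is_derive a y la -> is_derive b y lb -> is_derive (fun y => a y - b y) y (la - lb)).
{ intros a b y la lb Ha Hb. exact (is_derive_minus (V := R_NormedModule) a b y la lb Ha Hb). }
assert (Dx : forall (a : R -> R) y la, is_derive a y la -> is_derive (fun y => y * a y) y (1 * a y + y * la)).
{ intros a y la Ha. exact (is_derive_Rmult (fun y => y) a y 1 la (Did y) Ha). }
assert (Dcm : forall (c : R) (a : R -> R) y la, is_derive a y la -> is_derive (fun y => c * a y) y (c * la)).
{ intros c a y la Ha. evar_last. exact (is_derive_Rmult (fun _ => c) a y 0 la (Dc c y) Ha). simpl; ring. }
assert (Dem : forall (a : R -> R) t la, is_derive a t la ->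
  is_derive (fun t => exp (- 2 * t) * a t) t (- 2 * exp (- 2 * t) * a t + exp (- 2 * t) * la)).
{ intros a t la Ha. exact (is_derive_Rmult (fun t => exp (- 2 * t)) a t _ la (De t) Ha). }
split; [split; [|split; [|split; [|split; [|split]]]]|split; [|split; [|split]]].
- continuous_on_halfplane_tac; auto.
- continuous_on_halfplane_tac; auto.
- continuous_on_halfplane_tac; auto.
- continuous_on_halfplane_tac; auto.
- continuous_on_halfplane_tac; auto.
- intros x t Ht. split; [|split; [|split; [|split]]].
  + apply Dm; [apply is_derive_Rplus|]; auto. apply (Dx (fun x => W f 1%nat x t)); auto.
  + apply Dm; [apply is_derive_Rplus|]; auto.
    apply is_derive_Rplus; [apply (Dcm 1 (fun x => W f 1%nat x t)) | apply (Dx (fun x => W f 2%nat x t))]; auto.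
  + apply is_derive_right_derive; [exact Ht|].
    apply Dm; [apply is_derive_Rplus|]; [now apply Wt | now apply Vt |].
    apply (Dcm x (W f 1%nat x)); now apply Wt.
  + apply is_derive_right_derive; [exact Ht|].
    apply Dm; [apply is_derive_Rplus|]; [now apply Vt | |].
    * apply Dm; [apply (Dem (W f 2%nat x)) | apply (Dcm (M ^ 2) (W f O x))]; now apply Wt.
    * apply (Dcm x (V f 1%nat x)); now apply Vt.
  (* The term [- 2 * exp (- 2 * t)] from differentiating the coefficient matches the commutator of
     [d^2/dx^2] with [x d/dx], which is [2 d^2/dx^2]. *)
  + ring.
- continuous_on_halfplane_tac; auto.
- intros x t Ht. split.
  + apply is_derive_right_derive; [exact Ht|].
    apply Dm; [apply is_derive_Rplus|]; [now apply Wt | now apply Vt |].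
    apply is_derive_Rplus; [apply (Dcm 1 (W f 1%nat x)) | apply (Dcm x (W f 2%nat x))]; now apply Wt.
  + apply Dm; [apply is_derive_Rplus|]; [now apply Vx | |].
    * apply Dm; [apply (Dcm (exp (- 2 * t)) (fun x => W f 2%nat x t)) | apply (Dcm (M ^ 2) (fun x => W f O x t))]; now apply Wx.
    * apply (Dx (fun x => V f 1%nat x t)); now apply Vx.
- intros x. unfold W, V, wave_t. rewrite !wave_zero. unfold radius.
  replace (0 / 2) with 0 by field. rewrite Ropp_0, exp_0.
  replace (x + (1 - 1)) with x by ring. replace (x - (1 - 1)) with x by ring. field.
- intros x. unfold W, V, wave_t. rewrite !wave_zero. unfold radius.
  replace (0 / 2) with 0 by field. rewrite Ropp_0, exp_0.
  replace (x + (1 - 1)) with x by ring. replace (x - (1 - 1)) with x by ring.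
  unfold k. simpl. field.
Qed.

(** * Hypergeometric series *)

Lemma rising_one n : rising 1 n = RtoC (INR (fact n)).
Proof.
induction n as [|n IH]; [reflexivity|].
change (rising 1 (S n)) with (rising 1 n * (1 + INR n))%C.
rewrite IH. change (fact (S n)) with (S n * fact n)%nat.
rewrite mult_INR, S_INR, RtoC_mult, RtoC_plus. ring.
Qed.

Lemma RtoC_neq_0 x : x <> 0 -> RtoC x <> 0%C.
Proof. intros H K. apply H. now apply RtoC_inj. Qed.

Lemma hyp_coef_0 a b : hyp_coef a b 1 0 = 1%C.
Proof. unfold hyp_coef. simpl. field. Qed.

Lemma hyp_coef_S a b n :
  (hyp_coef a b 1 (S n) * RtoC ((INR n + 1) ^ 2)
   = hyp_coef a b 1 n * ((a + INR n) * (b + INR n)))%C.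
Proof.
unfold hyp_coef. rewrite !rising_one.
change (rising a (S n)) with (rising a n * (a + INR n))%C.
change (rising b (S n)) with (rising b n * (b + INR n))%C.
change (fact (S n)) with (S n * fact n)%nat.
rewrite mult_INR, S_INR.
assert (H1 : RtoC (INR (fact n)) <> 0%C) by (apply RtoC_neq_0, INR_fact_neq_0).
assert (H2 : RtoC (INR n + 1) <> 0%C).
{ apply RtoC_neq_0. generalize (pos_INR n); lra. }
replace (RtoC ((INR n + 1) ^ 2)) with (RtoC (INR n + 1) * RtoC (INR n + 1))%C
  by (rewrite <- RtoC_mult; f_equal; ring).
rewrite RtoC_mult. field. auto.
Qed.

Lemma is_lim_seq_Cmod_ratio a :
  is_lim_seq (fun n => Cmod (a + INR n) / (INR n + 1)) 1.
Proof.
assert (L : is_lim_seq (fun n => / (INR n + 1)) 0).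
{ apply (is_lim_seq_ext (fun n => / INR (S n))); [intros; now rewrite S_INR|].
  apply (is_lim_seq_incr_1 (fun n => / INR n)).
  evar_last. apply is_lim_seq_inv; [apply is_lim_seq_INR | easy]. reflexivity. }
apply (is_lim_seq_le_le (fun n => 1 - Cmod (a - 1) * / (INR n + 1)) _
   (fun n => 1 + Cmod (a - 1) * / (INR n + 1))).
- intros n. assert (Hn : 0 < INR n + 1) by (generalize (pos_INR n); lra).
  assert (HC : Cmod (RtoC (INR n + 1)) = INR n + 1) by (rewrite Cmod_R; apply Rabs_pos_eq; lra).
  assert (U : Cmod (a + INR n) <= Cmod (a - 1) + (INR n + 1)).
  { replace (a + INR n)%C with ((a - 1) + RtoC (INR n + 1))%C by (rewrite RtoC_plus; ring).
    rewrite <- HC at 2. apply Cmod_triangle. }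
  assert (D : INR n + 1 <= Cmod (a + INR n) + Cmod (a - 1)).
  { rewrite <- HC. replace (RtoC (INR n + 1)) with ((a + INR n) + - (a - 1))%C by (rewrite RtoC_plus; ring).
    rewrite <- (Cmod_opp (a - 1)). apply Cmod_triangle. }
  split.
  + apply Rmult_le_reg_r with (INR n + 1); [exact Hn|].
    replace ((1 - Cmod (a - 1) * / (INR n + 1)) * (INR n + 1)) with (INR n + 1 - Cmod (a - 1)) by (field; lra).
    replace (Cmod (a + INR n) / (INR n + 1) * (INR n + 1)) with (Cmod (a + INR n)) by (field; lra). lra.
  + apply Rmult_le_reg_r with (INR n + 1); [exact Hn|].
    replace ((1 + Cmod (a - 1) * / (INR n + 1)) * (INR n + 1)) with (INR n + 1 + Cmod (a - 1)) by (field; lra).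
    replace (Cmod (a + INR n) / (INR n + 1) * (INR n + 1)) with (Cmod (a + INR n)) by (field; lra). lra.
- evar_last. apply is_lim_seq_minus'; [apply is_lim_seq_const|].
  apply (is_lim_seq_scal_l _ (Cmod (a - 1)) 0 L). simpl. f_equal; ring.
- evar_last. apply is_lim_seq_plus'; [apply is_lim_seq_const|].
  apply (is_lim_seq_scal_l _ (Cmod (a - 1)) 0 L). simpl. f_equal; ring.
Qed.

Definition unit_radius (p : nat -> R) : Prop :=
  forall x, Rabs x < 1 -> Rbar_lt (Rabs x) (CV_radius p).

(** The ratio test is applied to the moduli of the complex coefficients, where the ratios tend to
    [1]; real and imaginary parts may vanish and need not have a limiting ratio, so they are
    compared with the moduli. The hypotheses on [a] and [b] keep the moduli positive. *)
Lemma unit_radius_of_hyp_coef a b (p : nat -> R) :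
  (forall n, a + INR n <> 0)%C -> (forall n, b + INR n <> 0)%C ->
  (forall n, Rabs (p n) <= Cmod (hyp_coef a b 1 n)) -> unit_radius p.
Proof.
intros Ha Hb Hp x Hx.
pose (m := fun n => Cmod (hyp_coef a b 1 n)).
assert (Hrec : forall n, m (S n) * (INR n + 1) ^ 2 = m n * (Cmod (a + INR n) * Cmod (b + INR n))).
{ intros n. unfold m. rewrite <- !Cmod_mult, <- hyp_coef_S, Cmod_mult, Cmod_R, (Rabs_pos_eq ((INR n + 1) ^ 2)).
  reflexivity. apply pow2_ge_0. }
assert (Hm : forall n, 0 < m n).
{ induction n as [|n IH].
  - unfold m. rewrite hyp_coef_0, Cmod_1. lra.
  - apply Rmult_lt_reg_r with ((INR n + 1) ^ 2).
    + apply pow_lt. generalize (pos_INR n); lra.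
    + rewrite Hrec, Rmult_0_l. apply Rmult_lt_0_compat; [exact IH|].
      apply Rmult_lt_0_compat; now apply Cmod_gt_0. }
assert (HR : CV_radius m = Finite 1).
{ rewrite <- Rinv_1. apply CV_radius_finite_DAlembert; [intros n; generalize (Hm n); lra | lra |].
  apply (is_lim_seq_ext (fun n => Cmod (a + INR n) / (INR n + 1) * (Cmod (b + INR n) / (INR n + 1)))).
  - intros n. assert (Hn : 0 < INR n + 1) by (generalize (pos_INR n); lra).
    assert (Hm0 := Hm n). assert (Hm1 := Hm (S n)).
    rewrite Rabs_pos_eq by (left; now apply Rdiv_lt_0_compat).
    apply Rmult_eq_reg_r with (m n * (INR n + 1) ^ 2).
    2: { apply Rmult_integral_contrapositive_currified; [lra|]. apply pow_nonzero; lra. }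
    transitivity (m n * (Cmod (a + INR n) * Cmod (b + INR n))); [field; lra|].
    rewrite <- Hrec. field. lra.
  - evar_last. apply is_lim_seq_mult'; apply is_lim_seq_Cmod_ratio. f_equal; ring. }
(* A point strictly between [Rabs x] and [1]: the radius is a supremum, so convergence at [r] gives
   the strict inequality at [x]. *)
pose (r := (1 + Rabs x) / 2).
assert (Hr : Rabs x < r < 1) by (unfold r; lra).
assert (Hr0 : 0 <= r) by (generalize (Rabs_pos x); lra).
apply Rbar_lt_le_trans with r; [exact (proj1 Hr)|].
apply (proj1 (Lub_Rbar_correct (CV_disk p))).
unfold CV_disk. apply (ex_series_le (K := R_AbsRing) (V := R_CompleteNormedModule) _ (fun n => Rabs (m n * r ^ n))).
- intros n. change (Rabs (Rabs (p n * r ^ n)) <= Rabs (m n * r ^ n)).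
  rewrite Rabs_Rabsolu, !Rabs_mult. apply Rmult_le_compat_r; [apply Rabs_pos|].
  rewrite (Rabs_pos_eq (m n)) by (left; apply Hm). apply Hp.
- apply CV_disk_inside. rewrite HR, (Rabs_pos_eq r) by exact Hr0. exact (proj2 Hr).
Qed.

Lemma im_le_Cmod (z : C) : Rabs (Im z) <= Cmod z.
Proof. apply Rle_trans with (2 := Rmax_Cmod z). apply Rmax_r. Qed.

Lemma unit_radius_derive p : unit_radius p -> unit_radius (PS_derive p).
Proof. intros Hp x Hx. rewrite CV_radius_derive. now apply Hp. Qed.

Lemma PSeries_index p x : x * PSeries (PS_derive p) x = PSeries (fun n => INR n * p n) x.
Proof.
rewrite <- PSeries_incr_1. apply PSeries_ext. intros [|n]; simpl; [unfold zero; simpl; ring | reflexivity].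
Qed.

Lemma unit_radius_index p : unit_radius p -> unit_radius (fun n => INR n * p n).
Proof.
intros Hp x Hx.
rewrite (CV_radius_ext _ (PS_incr_1 (PS_derive p))).
- rewrite CV_radius_incr_1. now apply unit_radius_derive.
- intros [|n]; simpl; [unfold zero; simpl; ring | reflexivity].
Qed.

(** The left side is [d/dx] applied to [x d/dx]. It produces the factor [(n + 1)^2] that stands in
    the recursion for the coefficients when [c = 1]. *)
Lemma PSeries_index_derive p x : unit_radius p -> Rabs x < 1 ->
  PSeries (PS_derive p) x + x * PSeries (PS_derive (PS_derive p)) x
  = PSeries (fun n => (INR n + 1) ^ 2 * p (S n)) x.
Proof.
intros Hp Hx.
assert (H1 := is_derive_PSeries _ x (unit_radius_index p Hp x Hx)).
assert (H2 : is_derive (fun y => y * PSeries (PS_derive p) y) x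
  (1 * PSeries (PS_derive p) x + x * PSeries (PS_derive (PS_derive p)) x)).
{ apply is_derive_Rmult; [exact (is_derive_id (K := R_AbsRing) x)|].
  apply is_derive_PSeries. now apply unit_radius_derive. }
apply (is_derive_ext (fun n => _) (PSeries (fun n => INR n * p n)) x) in H2; [|intros; apply PSeries_index].
rewrite <- (Rmult_1_l (PSeries (PS_derive p) x)).
apply is_derive_unique in H1, H2. rewrite <- H2, H1.
apply PSeries_ext. intros n. unfold PS_derive. rewrite S_INR. ring.
Qed.

Lemma unit_radius_ex_pseries p x : unit_radius p -> Rabs x < 1 -> ex_pseries p x.
Proof. intros Hp Hx. apply CV_radius_inside. now apply Hp. Qed.

Lemma unit_radius_lin (a b : R) p q :
  unit_radius p -> unit_radius q -> unit_radius (fun n => a * p n + b * q n).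
Proof.
intros Hp Hq x Hx.
apply Rbar_lt_le_trans with (2 := CV_radius_plus (PS_scal a p) (PS_scal b q)).
assert (H : forall c r, unit_radius r -> Rbar_lt (Rabs x) (CV_radius (PS_scal c r))).
{ intros c r Hr. destruct (Req_dec c 0) as [-> | Hc].
  - rewrite (CV_radius_ext _ (fun _ => 0)).
    + rewrite CV_radius_const_0. exact I.
    + intros n. unfold PS_scal, scal; simpl; unfold mult; simpl. ring.
  - rewrite CV_radius_scal by exact Hc. now apply Hr. }
unfold Rbar_min.
generalize (H a p Hp) (H b q Hq).
destruct (CV_radius (PS_scal a p)), (CV_radius (PS_scal b q)); simpl; try easy.
intros; now apply Rmin_glb_lt.
Qed.

Lemma PSeries_lin (a b : R) p q x :
  unit_radius p -> unit_radius q -> Rabs x < 1 ->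
  PSeries (fun n => a * p n + b * q n) x = a * PSeries p x + b * PSeries q x.
Proof.
intros Hp Hq Hx.
rewrite <- !PSeries_scal.
rewrite <- PSeries_plus.
- apply PSeries_ext. reflexivity.
- apply ex_pseries_scal; [apply Rmult_comm | now apply unit_radius_ex_pseries].
- apply ex_pseries_scal; [apply Rmult_comm | now apply unit_radius_ex_pseries].
Qed.

(** * Coefficients and equations of the two hypergeometric functions *)

Lemma half_plus_iM M : (half + iM M)%C = (1 / 2, M).
Proof. unfold half, iM, Ci, RtoC, Cplus, Cmult; simpl. f_equal; ring. Qed.

Lemma minus_half_plus_iM M : (- half + iM M)%C = (- 1 / 2, M).
Proof. unfold half, iM, Ci, RtoC, Cplus, Cmult, Copp; simpl. f_equal; field. Qed.

Lemma minus_half_minus_iM M : (- half - iM M)%C = (- 1 / 2, - M).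
Proof. unfold half, iM, Ci, RtoC, Cminus, Cplus, Cmult, Copp; simpl. f_equal; field. Qed.

Lemma half_plus_iM_nat_neq_0 M n : (half + iM M + INR n <> 0)%C.
Proof.
rewrite half_plus_iM. intros H. apply (f_equal fst) in H. simpl in H.
generalize (pos_INR n); lra.
Qed.

Lemma minus_half_plus_iM_nat_neq_0 M n : (- half + iM M + INR n <> 0)%C.
Proof.
rewrite minus_half_plus_iM. intros H. apply (f_equal fst) in H. simpl in H.
destruct n as [|n]; [simpl in H; lra|]. rewrite S_INR in H. generalize (pos_INR n); lra.
Qed.

Definition coef (M : R) : nat -> C := hyp_coef (half + iM M) (half + iM M) 1.
Definition coef' (M : R) : nat -> C := hyp_coef (- half + iM M) (half + iM M) 1.
Definition cre (M : R) (n : nat) : R := Re (coef M n).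
Definition cim (M : R) (n : nat) : R := Im (coef M n).
Definition cre' (M : R) (n : nat) : R := Re (coef' M n).
Definition cim' (M : R) (n : nat) : R := Im (coef' M n).

Lemma unit_radius_cre M : unit_radius (cre M).
Proof.
apply (unit_radius_of_hyp_coef (half + iM M) (half + iM M)).
- apply half_plus_iM_nat_neq_0. - apply half_plus_iM_nat_neq_0. - intros; apply re_le_Cmod.
Qed.

Lemma unit_radius_cim M : unit_radius (cim M).
Proof.
apply (unit_radius_of_hyp_coef (half + iM M) (half + iM M)).
- apply half_plus_iM_nat_neq_0. - apply half_plus_iM_nat_neq_0. - intros; apply im_le_Cmod.
Qed.

Lemma unit_radius_cre' M : unit_radius (cre' M).
Proof.
apply (unit_radius_of_hyp_coef (- half + iM M) (half + iM M)).
- apply minus_half_plus_iM_nat_neq_0. - apply half_plus_iM_nat_neq_0. - intros; apply re_le_Cmod.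
Qed.

Lemma unit_radius_cim' M : unit_radius (cim' M).
Proof.
apply (unit_radius_of_hyp_coef (- half + iM M) (half + iM M)).
- apply minus_half_plus_iM_nat_neq_0. - apply half_plus_iM_nat_neq_0. - intros; apply im_le_Cmod.
Qed.

Lemma coef_S M n :
  (INR n + 1) ^ 2 * cre M (S n)
  = ((INR n + 1 / 2) ^ 2 - M ^ 2) * cre M n - 2 * M * (INR n + 1 / 2) * cim M n /\
  (INR n + 1) ^ 2 * cim M (S n)
  = ((INR n + 1 / 2) ^ 2 - M ^ 2) * cim M n + 2 * M * (INR n + 1 / 2) * cre M n.
Proof.
assert (H := hyp_coef_S (half + iM M) (half + iM M) n).
unfold cre, cim, coef. set (a := hyp_coef _ _ 1 (S n)) in *. set (b := hyp_coef _ _ 1 n) in *.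
rewrite half_plus_iM in H. clearbody a b. destruct a as [a1 a2], b as [b1 b2].
assert (H1 := f_equal fst H). assert (H2 := f_equal snd H).
unfold Cmult, Cplus, RtoC in H1, H2; cbn [fst snd] in H1, H2. unfold Re, Im; simpl fst; simpl snd. split.
- lra.
- lra.
Qed.

Lemma rising_pred (a : C) n : (rising (a - 1) n * (a - 1 + INR n) = (a - 1) * rising a n)%C.
Proof.
induction n as [|n IH].
- simpl. ring.
- change (rising (a - 1) (S n)) with (rising (a - 1) n * (a - 1 + INR n))%C.
  change (rising a (S n)) with (rising a n * (a + INR n))%C.
  rewrite IH, S_INR, RtoC_plus. ring.
Qed.

Lemma coef'_coef M n :
  (coef' M n * (half + iM M - 1 + INR n) = (half + iM M - 1) * coef M n)%C.
Proof.
unfold coef', coef, hyp_coef. rewrite !rising_one.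
replace (- half + iM M)%C with (half + iM M - 1)%C.
2: { unfold half, iM, Ci, RtoC, Cminus, Cplus, Cmult, Copp; simpl. f_equal; field. }
assert (H1 : RtoC (INR (fact n)) <> 0%C) by (apply RtoC_neq_0, INR_fact_neq_0).
transitivity ((rising (half + iM M - 1) n * (half + iM M - 1 + INR n)) * rising (half + iM M) n
  / (INR (fact n) * INR (fact n)))%C; [field; exact H1|].
rewrite rising_pred. field. exact H1.
Qed.

(** This is the coefficient of [x^(n+1)] in the contiguity relation. It is proved after
    multiplication by [a + n], which is nonzero because its real part is positive. *)
Lemma coef'_S M n :
  ((1 - (half + iM M)) * coef' M (S n)
   = (INR n + 2 - (half + iM M)) * coef M (S n) - (INR n + (half + iM M)) * coef M n)%C.
Proof.
assert (H1 := coef'_coef M (S n)).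
assert (H2 := hyp_coef_S (half + iM M) (half + iM M) n). fold (coef M) in H2.
assert (H0 := half_plus_iM_nat_neq_0 M n).
rewrite S_INR in H1. rewrite RtoC_plus in H1.
replace (RtoC ((INR n + 1) ^ 2)) with ((INR n + 1) * (INR n + 1))%C in H2
  by (rewrite <- RtoC_plus, <- RtoC_mult; f_equal; ring).
revert H0 H1 H2.
generalize (half + iM M)%C (coef M (S n)) (coef M n) (coef' M (S n)) (RtoC (INR n)).
intros a c1 c0 d m H0 H1 H2.
assert (K : ((a + m) * ((1 - a) * d - ((m + 2 - a) * c1 - (m + a) * c0)) = 0)%C).
{ transitivity ((1 - a) * (d * (a - 1 + (m + 1)) - (a - 1) * c1) + (c0 * ((a + m) * (a + m)) - c1 * ((m + 1) * (m + 1))))%C; [ring|].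
  rewrite H1, H2. ring. }
assert (L : ((1 - a) * d - ((m + 2 - a) * c1 - (m + a) * c0) = 0)%C).
{ transitivity (/ (a + m) * ((a + m) * ((1 - a) * d - ((m + 2 - a) * c1 - (m + a) * c0))))%C; [field; exact H0|].
  rewrite K. ring. }
transitivity (((1 - a) * d - ((m + 2 - a) * c1 - (m + a) * c0)) + ((m + 2 - a) * c1 - (m + a) * c0))%C; [ring|].
rewrite L. ring.
Qed.

Definition Fre (M x : R) : R := PSeries (cre M) x.
Definition Fim (M x : R) : R := PSeries (cim M) x.
Definition Fre1 (M x : R) : R := PSeries (PS_derive (cre M)) x.
Definition Fim1 (M x : R) : R := PSeries (PS_derive (cim M)) x.
Definition Fre2 (M x : R) : R := PSeries (PS_derive (PS_derive (cre M))) x.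
Definition Fim2 (M x : R) : R := PSeries (PS_derive (PS_derive (cim M))) x.

Lemma x_Fre1 M x : x * Fre1 M x = PSeries (fun n => INR n * cre M n) x.
Proof. apply PSeries_index. Qed.

Lemma x_Fim1 M x : x * Fim1 M x = PSeries (fun n => INR n * cim M n) x.
Proof. apply PSeries_index. Qed.

Lemma x_index_derive p x : unit_radius p -> Rabs x < 1 ->
  x * (PSeries (PS_derive p) x + x * PSeries (PS_derive (PS_derive p)) x)
  = PSeries (fun n => INR n * (INR n * p n)) x.
Proof.
intros Hp Hx. rewrite PSeries_index_derive by assumption.
rewrite <- PSeries_index. f_equal. apply PSeries_ext. intros n. unfold PS_derive. rewrite S_INR. ring.
Qed.

Ltac unit_radius_tac := repeat (assumption || apply unit_radius_lin).

(** Real and imaginary parts of the hypergeometric equation, read off from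
    [(n + 1)^2 c_(n+1) = (n + a)^2 c_n] by expanding [(n + a)^2] in powers of [n]. *)
Lemma hyp_ode M x : Rabs x < 1 ->
  x * (1 - x) * Fre2 M x + (1 - 2 * x) * Fre1 M x + 2 * M * x * Fim1 M x
    - ((1 / 4 - M ^ 2) * Fre M x - M * Fim M x) = 0 /\
  x * (1 - x) * Fim2 M x + (1 - 2 * x) * Fim1 M x - 2 * M * x * Fre1 M x
    - ((1 / 4 - M ^ 2) * Fim M x + M * Fre M x) = 0.
Proof.
intros Hx.
assert (Up := unit_radius_cre M). assert (Uq := unit_radius_cim M).
assert (Up1 := unit_radius_index _ Up). assert (Uq1 := unit_radius_index _ Uq).
assert (Up2 := unit_radius_index _ Up1). assert (Uq2 := unit_radius_index _ Uq1).
assert (A1 := PSeries_index_derive (cre M) x Up Hx).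
assert (A2 := PSeries_index_derive (cim M) x Uq Hx).
assert (B1 := x_index_derive (cre M) x Up Hx).
assert (B2 := x_index_derive (cim M) x Uq Hx).
assert (C1 := x_Fre1 M x). assert (C2 := x_Fim1 M x).
(* The factors [1] and the nesting bring the right side into the binary shape [a * p n + b * q n] to
   which [PSeries_lin] applies. *)
assert (E1 := PSeries_ext (fun n => (INR n + 1) ^ 2 * cre M (S n))
  (fun n => 1 * (INR n * (INR n * cre M n)) + 1 * (1 * (INR n * cre M n)
    + 1 * (- 2 * M * (INR n * cim M n) + 1 * ((1 / 4 - M ^ 2) * cre M n + - M * cim M n)))) x
  ltac:(intros n; cbv beta; rewrite (proj1 (coef_S M n)); field)).
rewrite !PSeries_lin in E1 by unit_radius_tac.
assert (E2 := PSeries_ext (fun n => (INR n + 1) ^ 2 * cim M (S n))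
  (fun n => 1 * (INR n * (INR n * cim M n)) + 1 * (1 * (INR n * cim M n)
    + 1 * (2 * M * (INR n * cre M n) + 1 * ((1 / 4 - M ^ 2) * cim M n + M * cre M n)))) x
  ltac:(intros n; cbv beta; rewrite (proj2 (coef_S M n)); field)).
rewrite !PSeries_lin in E2 by unit_radius_tac.
rewrite <- A1, <- B1, <- C1, <- C2 in E1.
rewrite <- A2, <- B2, <- C1, <- C2 in E2.
fold (Fre M x) (Fim M x) (Fre1 M x) (Fim1 M x) (Fre2 M x) (Fim2 M x) in E1, E2.
split; lra.
Qed.

(** The left sides are the real and imaginary parts of [(1 - a) F(a - 1, a; 1; x)] with
    [a = 1/2 + i M]. *)
Lemma hyp_contiguity M x : Rabs x < 1 ->
  1 / 2 * PSeries (cre' M) x + M * PSeries (cim' M) x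
  = x * (1 - x) * Fre1 M x + (1 / 2 * Fre M x + M * Fim M x) - x * (1 / 2 * Fre M x - M * Fim M x) /\
  1 / 2 * PSeries (cim' M) x - M * PSeries (cre' M) x
  = x * (1 - x) * Fim1 M x + (1 / 2 * Fim M x - M * Fre M x) - x * (1 / 2 * Fim M x + M * Fre M x).
Proof.
intros Hx.
assert (Up := unit_radius_cre M). assert (Uq := unit_radius_cim M).
assert (Up1 := unit_radius_index _ Up). assert (Uq1 := unit_radius_index _ Uq).
assert (Up' := unit_radius_cre' M). assert (Uq' := unit_radius_cim' M).
assert (C1 := x_Fre1 M x). assert (C2 := x_Fim1 M x).
assert (UI : forall r, unit_radius r -> unit_radius (PS_incr_1 r)).
{ intros r Hr y Hy. rewrite CV_radius_incr_1. now apply Hr. }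
assert (H0 : coef M 0 = 1%C) by apply hyp_coef_0.
assert (H0' : coef' M 0 = 1%C) by apply hyp_coef_0.
(* [PS_incr_1] is multiplication by [x]. The constant term is compared separately, since [coef'_S]
   concerns the degrees from one on. *)
assert (K1 : PSeries (fun n => 1 / 2 * cre' M n + M * cim' M n) x
  = PSeries (fun n => 1 * (1 * (INR n * cre M n) + 1 * (1 / 2 * cre M n + M * cim M n))
     + -1 * PS_incr_1 (fun n => 1 * (INR n * cre M n) + 1 * (1 / 2 * cre M n + - M * cim M n)) n) x).
{ apply PSeries_ext. intros [|n].
  - unfold cre, cim, cre', cim'. rewrite H0, H0'. simpl. unfold zero; simpl. ring.
  - assert (K := f_equal Re (coef'_S M n)). rewrite half_plus_iM in K.
    unfold cre, cim, cre', cim', PS_incr_1.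
    destruct (coef M (S n)) as [a1 a2], (coef M n) as [b1 b2], (coef' M (S n)) as [d1 d2].
    cbv [Cmult Cplus Cminus Copp RtoC Re Im fst snd] in K |- *.
    rewrite S_INR. lra. }
assert (K2 : PSeries (fun n => 1 / 2 * cim' M n + - M * cre' M n) x
  = PSeries (fun n => 1 * (1 * (INR n * cim M n) + 1 * (1 / 2 * cim M n + - M * cre M n))
     + -1 * PS_incr_1 (fun n => 1 * (INR n * cim M n) + 1 * (1 / 2 * cim M n + M * cre M n)) n) x).
{ apply PSeries_ext. intros [|n].
  - unfold cre, cim, cre', cim'. rewrite H0, H0'. simpl. unfold zero; simpl. ring.
  - assert (K := f_equal Im (coef'_S M n)). rewrite half_plus_iM in K.
    unfold cre, cim, cre', cim', PS_incr_1.
    destruct (coef M (S n)) as [a1 a2], (coef M n) as [b1 b2], (coef' M (S n)) as [d1 d2].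
    cbv [Cmult Cplus Cminus Copp RtoC Re Im fst snd] in K |- *.
    rewrite S_INR. lra. }
rewrite (PSeries_lin 1 (-1)), PSeries_incr_1 in K1, K2 by (try apply UI; unit_radius_tac).
rewrite !PSeries_lin in K1, K2 by unit_radius_tac.
rewrite <- C1 in K1. rewrite <- C2 in K2. fold (Fre M x) (Fim M x) in K1, K2.
split; lra.
Qed.

(** * The radial profile *)

(* Real part of [(1 + w)^(- 1/2 - i M) (P + i Q) (w / (1 + w))]. *)
Definition twist (M : R) (P Q : R -> R) (w : R) : R :=
  exp (- / 2 * ln (1 + w)) *
  (cos (M * ln (1 + w)) * P (w / (1 + w)) + sin (M * ln (1 + w)) * Q (w / (1 + w))).

(* With [a = 1/2 + i M] and [f = P + i Q], differentiating
   [(1 + w)^(- a) f (w / (1 + w))] turns [f] into [(1 - x) (- a f + (1 - x) f')];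
   [tderiv M P Q P1] and [tderiv (- M) Q P Q1] are its two components. *)
Definition tderiv (M : R) (P Q P1 : R -> R) (x : R) : R :=
  (1 - x) * (- / 2 * P x + M * Q x + (1 - x) * P1 x).

Definition tderiv' (M : R) (P Q P1 Q1 P2 : R -> R) (x : R) : R :=
  - (- / 2 * P x + M * Q x + (1 - x) * P1 x)
  + (1 - x) * (- / 2 * P1 x + M * Q1 x - P1 x + (1 - x) * P2 x).

Definition twist1 M P P1 Q Q1 := twist M (tderiv M P Q P1) (tderiv (- M) Q P Q1).

Definition twist2 M P P1 P2 Q Q1 Q2 :=
  twist M (tderiv M (tderiv M P Q P1) (tderiv (- M) Q P Q1) (tderiv' M P Q P1 Q1 P2))
    (tderiv (- M) (tderiv (- M) Q P Q1) (tderiv M P Q P1) (tderiv' (- M) Q P Q1 P1 Q2)).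

Lemma is_derive_twist M P P1 Q Q1 w : - 1 < w ->
  is_derive P (w / (1 + w)) (P1 (w / (1 + w))) -> is_derive Q (w / (1 + w)) (Q1 (w / (1 + w))) ->
  is_derive (twist M P Q) w (twist1 M P P1 Q Q1 w).
Proof.
intros Hw HP HQ. unfold twist.
assert (Dz : is_derive (fun w => w / (1 + w)) w (/ (1 + w) ^ 2)).
{ auto_derive; [lra | field; lra]. }
assert (Dl : is_derive (fun w => ln (1 + w)) w (/ (1 + w))).
{ auto_derive; [lra | field; lra]. }
assert (Dml : is_derive (fun w => M * ln (1 + w)) w (M * / (1 + w))).
{ auto_derive; [lra | field; lra]. }
assert (Dhl : is_derive (fun w => - / 2 * ln (1 + w)) w (- / 2 * / (1 + w))).
{ auto_derive; [lra | field; lra]. }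
evar_last.
- apply is_derive_Rmult.
  + apply (is_derive_comp_R exp (fun w => - / 2 * ln (1 + w)) w); [apply is_derive_exp | exact Dhl].
  + apply is_derive_Rplus; apply is_derive_Rmult.
    * apply (is_derive_comp_R cos (fun w => M * ln (1 + w)) w); [apply is_derive_cos | exact Dml].
    * apply (is_derive_comp_R P (fun w => w / (1 + w)) w); [exact HP | exact Dz].
    * apply (is_derive_comp_R sin (fun w => M * ln (1 + w)) w); [apply is_derive_sin | exact Dml].
    * apply (is_derive_comp_R Q (fun w => w / (1 + w)) w); [exact HQ | exact Dz].
- unfold twist1, twist, tderiv.
  replace (1 - w / (1 + w)) with (/ (1 + w)) by (field; lra).
  field. lra.
Qed.

Lemma is_derive_tderiv M P P1 P2 Q Q1 x :
  is_derive P x (P1 x) -> is_derive Q x (Q1 x) -> is_derive P1 x (P2 x) ->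
  is_derive (tderiv M P Q P1) x (tderiv' M P Q P1 Q1 P2 x).
Proof.
intros HP HQ HP1. unfold tderiv.
assert (D1 : is_derive (fun x => 1 - x) x (- 1)) by (auto_derive; [easy | ring]).
evar_last.
- apply is_derive_Rmult; [exact D1|]. apply is_derive_Rplus; [apply is_derive_Rplus|].
  + apply is_derive_Rmult; [apply (is_derive_const (- / 2)) | exact HP].
  + apply is_derive_Rmult; [apply (is_derive_const M) | exact HQ].
  + apply is_derive_Rmult; [exact D1 | exact HP1].
- unfold tderiv', zero; simpl. ring.
Qed.

(* [f = P + i Q] solves the hypergeometric equation with parameters
   [1/2 + i M, 1/2 + i M; 1]. *)
Definition hyp_system (M : R) (P P1 P2 Q Q1 Q2 : R -> R) : Prop :=
  forall x, Rabs x < 1 ->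
  is_derive P x (P1 x) /\ is_derive P1 x (P2 x) /\ continuous P2 x /\
  is_derive Q x (Q1 x) /\ is_derive Q1 x (Q2 x) /\ continuous Q2 x /\
  x * (1 - x) * P2 x + (1 - 2 * x) * P1 x + 2 * M * x * Q1 x
    - ((1 / 4 - M ^ 2) * P x - M * Q x) = 0 /\
  x * (1 - x) * Q2 x + (1 - 2 * x) * Q1 x - 2 * M * x * P1 x
    - ((1 / 4 - M ^ 2) * Q x + M * P x) = 0.

(** At [w = - 1/2] the quotient reaches [- 1]. The half-line [w > - 1/2] is open and contains [0],
    so the derivatives at the boundary of the light cone are two-sided. *)
Lemma ratio_lt_1 w : - / 2 < w -> Rabs (w / (1 + w)) < 1.
Proof.
intros Hw. apply Rabs_def1.
- apply Rmult_lt_reg_r with (1 + w); [lra|]. replace (w / (1 + w) * (1 + w)) with w by (field; lra). lra.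
- apply Rmult_lt_reg_r with (1 + w); [lra|]. replace (w / (1 + w) * (1 + w)) with w by (field; lra). lra.
Qed.

Lemma is_derive_twist_0 M P P1 P2 Q Q1 Q2 w :
  hyp_system M P P1 P2 Q Q1 Q2 -> - / 2 < w ->
  is_derive (twist M P Q) w (twist1 M P P1 Q Q1 w).
Proof.
intros H Hw. destruct (H _ (ratio_lt_1 w Hw)) as (HP & _ & _ & HQ & _).
apply is_derive_twist; [lra | exact HP | exact HQ].
Qed.

Lemma is_derive_twist_1 M P P1 P2 Q Q1 Q2 w :
  hyp_system M P P1 P2 Q Q1 Q2 -> - / 2 < w ->
  is_derive (twist1 M P P1 Q Q1) w (twist2 M P P1 P2 Q Q1 Q2 w).
Proof.
intros H Hw. destruct (H _ (ratio_lt_1 w Hw)) as (HP & HP1 & _ & HQ & HQ1 & _).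
apply is_derive_twist; [lra | now apply is_derive_tderiv | now apply is_derive_tderiv].
Qed.

Lemma continuous_twist_2 M P P1 P2 Q Q1 Q2 w :
  hyp_system M P P1 P2 Q Q1 Q2 -> - / 2 < w ->
  continuous (twist2 M P P1 P2 Q Q1 Q2) w.
Proof.
intros H Hw. destruct (H _ (ratio_lt_1 w Hw)) as (HP & HP1 & HP2 & HQ & HQ1 & HQ2 & _).
apply continuous_derive in HP, HP1, HQ, HQ1.
assert (Cl : continuous (fun w => ln (1 + w)) w).
{ apply (continuous_derive _ _ (/ (1 + w))). auto_derive; [lra | field; lra]. }
assert (Cz : continuous (fun w => w / (1 + w)) w).
{ apply (continuous_derive _ _ (/ (1 + w) ^ 2)). auto_derive; [lra | field; lra]. }
assert (CC : forall g : R -> R, continuous g (w / (1 + w)) -> continuous (fun w => g (w / (1 + w))) w).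
{ intros g Hg. now apply (continuous_comp_R g (fun w => w / (1 + w))). }
apply CC in HP, HP1, HP2, HQ, HQ1, HQ2.
assert (Ccos : continuous (fun w => cos (M * ln (1 + w))) w).
{ apply (continuous_comp_R cos (fun w => M * ln (1 + w))); [continuous_R | apply continuous_cos]. }
assert (Csin : continuous (fun w => sin (M * ln (1 + w))) w).
{ apply (continuous_comp_R sin (fun w => M * ln (1 + w))); [continuous_R | apply continuous_sin]. }
unfold twist2, twist, tderiv', tderiv. continuous_R.
Qed.

(** Pfaff's transformation at the level of the equation: the parameters [a, a; 1] in [w / (1 + w)]
    become [a, 1 - a; 1] in [- w], and [a * (1 - a) = 1/4 + M^2]. *)
Lemma twist_ode M P P1 P2 Q Q1 Q2 w :
  hyp_system M P P1 P2 Q Q1 Q2 -> - / 2 < w ->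
  w * (1 + w) * twist2 M P P1 P2 Q Q1 Q2 w + (1 + 2 * w) * twist1 M P P1 Q Q1 w
    + (1 / 4 + M ^ 2) * twist M P Q w = 0.
Proof.
intros H Hw. destruct (H _ (ratio_lt_1 w Hw)) as (_ & _ & _ & _ & _ & _ & E1 & E2).
unfold twist2, twist1, twist.
set (x := w / (1 + w)) in *.
assert (Hx : w = x / (1 - x)).
{ unfold x. field. lra. }
assert (Hx1 : 1 - x <> 0).
{ unfold x. replace (1 - w / (1 + w)) with (/ (1 + w)) by (field; lra). apply Rinv_neq_0_compat; lra. }
generalize (exp (- / 2 * ln (1 + w))) (cos (M * ln (1 + w))) (sin (M * ln (1 + w))).
intros e c s.
unfold tderiv, tderiv'.
clearbody x. rewrite Hx. clear Hx Hw.
revert E1 E2.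
generalize (P x) (P1 x) (P2 x) (Q x) (Q1 x) (Q2 x). intros p p1 p2 q q1 q2 E1 E2.
transitivity (e * (1 - x) * (c * (x * (1 - x) * p2 + (1 - 2 * x) * p1 + 2 * M * x * q1
    - ((1 / 4 - M ^ 2) * p - M * q)) + s * (x * (1 - x) * q2 + (1 - 2 * x) * q1 - 2 * M * x * p1
    - ((1 / 4 - M ^ 2) * q + M * p)))).
- field. exact Hx1.
- rewrite E1, E2. ring.
Qed.

Lemma hyp_system_F M : hyp_system M (Fre M) (Fre1 M) (Fre2 M) (Fim M) (Fim1 M) (Fim2 M).
Proof.
intros x Hx. destruct (hyp_ode M x Hx) as [E1 E2].
assert (Up := unit_radius_cre M). assert (Uq := unit_radius_cim M).
assert (Up1 := unit_radius_derive _ Up). assert (Uq1 := unit_radius_derive _ Uq).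
assert (Up2 := unit_radius_derive _ Up1). assert (Uq2 := unit_radius_derive _ Uq1).
refine (conj _ (conj _ (conj _ (conj _ (conj _ (conj _ (conj E1 E2))))))).
- apply is_derive_PSeries; auto.
- apply is_derive_PSeries; auto.
- apply continuity_pt_filterlim, PSeries_continuity; auto.
- apply is_derive_PSeries; auto.
- apply is_derive_PSeries; auto.
- apply continuity_pt_filterlim, PSeries_continuity; auto.
Qed.

(* Multiplication of [f] by [- i]. *)
Lemma hyp_system_rotate M P P1 P2 Q Q1 Q2 :
  hyp_system M P P1 P2 Q Q1 Q2 ->
  hyp_system M Q Q1 Q2 (fun x => - P x) (fun x => - P1 x) (fun x => - P2 x).
Proof.
intros H x Hx. destruct (H x Hx) as (HP & HP1 & HP2 & HQ & HQ1 & HQ2 & E1 & E2).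
split; [exact HQ|]. split; [exact HQ1|]. split; [exact HQ2|].
split; [exact (is_derive_opp P x _ HP)|]. split; [exact (is_derive_opp P1 x _ HP1)|].
split; [now apply continuous_Ropp|]. split; lra.
Qed.

Lemma Fre_0 M : Fre M 0 = 1.
Proof. unfold Fre. rewrite PSeries_0. unfold cre, coef. now rewrite hyp_coef_0. Qed.

Lemma Fim_0 M : Fim M 0 = 0.
Proof. unfold Fim. rewrite PSeries_0. unfold cim, coef. now rewrite hyp_coef_0. Qed.

Lemma twist_at_0 M P Q : twist M P Q 0 = P 0.
Proof.
unfold twist. replace (0 / (1 + 0)) with 0 by field.
rewrite Rplus_0_r, ln_1, !Rmult_0_r, exp_0, cos_0, sin_0. ring.
Qed.

(* [w (1 + w) g'^2 + (1/4 + M^2) g^2] is nonincreasing on [w >= 0]. *)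
Lemma twist_vanish M P P1 P2 Q Q1 Q2 w :
  hyp_system M P P1 P2 Q Q1 Q2 -> P 0 = 0 -> 0 <= w ->
  twist M P Q w = 0 /\ twist1 M P P1 Q Q1 w = 0.
Proof.
intros H H0 Hw.
set (g := twist M P Q). set (g1 := twist1 M P P1 Q Q1). set (g2 := twist2 M P P1 P2 Q Q1 Q2).
assert (D0 : forall y, 0 <= y -> is_derive g y (g1 y)).
{ intros y Hy. apply (is_derive_twist_0 M P P1 P2 Q Q1 Q2); [exact H | lra]. }
assert (D1 : forall y, 0 <= y -> is_derive g1 y (g2 y)).
{ intros y Hy. apply is_derive_twist_1; [exact H | lra]. }
assert (O : forall y, 0 <= y -> y * (1 + y) * g2 y + (1 + 2 * y) * g1 y + (1 / 4 + M ^ 2) * g y = 0).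
{ intros y Hy. apply twist_ode; [exact H | lra]. }
assert (G0 : g 0 = 0) by (unfold g; now rewrite twist_at_0).
pose (en := fun y => y * (1 + y) * (g1 y * g1 y) + (1 / 4 + M ^ 2) * (g y * g y)).
assert (Den : forall y, 0 <= y -> is_derive en y (- (1 + 2 * y) * (g1 y * g1 y))).
{ intros y Hy. unfold en. evar_last.
  - apply is_derive_Rplus; apply is_derive_Rmult.
    + instantiate (1 := 1 + 2 * y). auto_derive; [easy | ring].
    + apply is_derive_Rmult; apply D1, Hy.
    + apply (is_derive_const (1 / 4 + M ^ 2)).
    + apply is_derive_Rmult; apply D0, Hy.
  - unfold zero; simpl.
    transitivity (2 * g1 y * (y * (1 + y) * g2 y + (1 + 2 * y) * g1 y + (1 / 4 + M ^ 2) * g y)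
      - (1 + 2 * y) * (g1 y * g1 y)); [ring|]. rewrite (O y Hy). ring. }
assert (Hen : en w <= 0).
{ destruct (MVT_gen en 0 w (fun y => - (1 + 2 * y) * (g1 y * g1 y))) as [c [Hc1 Hc2]].
  - intros y Hy. rewrite Rmin_left in Hy by lra. apply Den; lra.
  - intros y Hy. rewrite Rmin_left in Hy by lra. apply continuity_pt_filterlim.
    apply (continuous_derive _ _ _ (Den y (proj1 Hy))).
  - rewrite Rmin_left in Hc1 by lra. unfold en at 2 in Hc2. rewrite G0 in Hc2.
    assert (0 <= (1 + 2 * c) * (g1 c * g1 c) * w).
    { apply Rmult_le_pos; [|lra]. apply Rmult_le_pos; [lra | apply Rle_0_sqr]. }
    lra. }
assert (Hg : g w = 0).
{ assert (0 <= w * (1 + w) * (g1 w * g1 w)).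
  { apply Rmult_le_pos; [apply Rmult_le_pos; lra | apply Rle_0_sqr]. }
  unfold en in Hen. assert (0 <= M ^ 2) by apply pow2_ge_0.
  assert (K : g w * g w <= 0). { assert (0 <= g w * g w) by apply Rle_0_sqr. nra. }
  apply Rsqr_0_uniq. apply Rle_antisym; [exact K | apply Rle_0_sqr]. }
split; [exact Hg|].
destruct (Rle_lt_or_eq_dec 0 w Hw) as [Hp | <-].
- unfold en in Hen. rewrite Hg in Hen.
  apply Rsqr_0_uniq. apply Rle_antisym; [|apply Rle_0_sqr]. unfold Rsqr.
  apply Rmult_le_reg_l with (w * (1 + w)); [apply Rmult_lt_0_compat; lra|]. lra.
(* At [w = 0] the energy carries no information on [g1], but there the equation reduces to
   [g1 0 + (1/4 + M^2) * g 0 = 0]. *)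
- generalize (O 0 (Rle_refl 0)). rewrite G0. lra.
Qed.

Definition hre M := twist M (Fre M) (Fim M).
Definition hre1 M := twist1 M (Fre M) (Fre1 M) (Fim M) (Fim1 M).
Definition hre2 M := twist2 M (Fre M) (Fre1 M) (Fre2 M) (Fim M) (Fim1 M) (Fim2 M).
(** The imaginary part of [H], obtained as the real part of [- i H] so that everything proved about
    [twist] covers it. *)
Definition him M := twist M (Fim M) (fun x => - Fre M x).
Definition him1 M := twist1 M (Fim M) (Fim1 M) (fun x => - Fre M x) (fun x => - Fre1 M x).

(** [hre M] is known to be C^2 only for [w > - 1/2]; replacing it on [w < 0] by its quadratic Taylor
    polynomial at [0] gives a C^2 function on the whole line. *)
Definition profile M w := hre M (Rmax w 0) + hre1 M 0 * Rmin w 0 + hre2 M 0 * Rmin w 0 ^ 2 / 2.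
Definition profile1 M w := hre1 M (Rmax w 0) + hre2 M 0 * Rmin w 0.
Definition profile2 M w := hre2 M (Rmax w 0).

Lemma profile_nonneg M w : 0 <= w ->
  profile M w = hre M w /\ profile1 M w = hre1 M w /\ profile2 M w = hre2 M w.
Proof.
intros Hw. unfold profile, profile1, profile2. rewrite Rmax_left, Rmin_right by lra.
repeat split; field.
Qed.

Lemma radial_profile_hyp M : radial_profile M (profile M) (profile1 M) (profile2 M).
Proof.
assert (S := hyp_system_F M).
split; [|split; [|split; [|split]]].
- apply is_derive_glue. intros t Ht. apply is_derive_right_derive; [exact Ht|].
  apply (is_derive_twist_0 M _ _ (Fre2 M) _ _ (Fim2 M)); [exact S | lra].
- intros w. unfold profile1, profile2.
  apply (is_derive_ext (fun w => hre1 M (Rmax w 0) + hre2 M 0 * Rmin w 0 + 0 * Rmin w 0 ^ 2 / 2)).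
  { intros t. simpl. field. }
  evar_last. apply (is_derive_glue (hre1 M) (hre2 M) 0).
  + intros t Ht. apply is_derive_right_derive; [exact Ht|]. apply is_derive_twist_1; [exact S | lra].
  + ring.
- intros w. apply (continuous_comp_R (hre2 M) (fun w => Rmax w 0)); [apply continuous_pos_part|].
  apply continuous_twist_2; [exact S|]. generalize (Rmax_r w 0); lra.
- rewrite (proj1 (profile_nonneg M 0 (Rle_refl 0))). unfold hre. rewrite twist_at_0. apply Fre_0.
- intros w Hw. destruct (profile_nonneg M w Hw) as (-> & -> & ->).
  apply twist_ode; [exact S | lra].
Qed.

(** * Complex-valued kernels *)

Lemma norm_C_le (x : C) : norm (x : C_R_NormedModule) <= Rabs (fst x) + Rabs (snd x).
Proof.
destruct x as [a b]. change (sqrt (Rabs a ^ 2 + Rabs b ^ 2) <= Rabs a + Rabs b).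
generalize (Rabs_pos a) (Rabs_pos b). intros Ha Hb.
apply Rsqr_incr_0_var; [|lra]. rewrite Rsqr_sqrt by nra. unfold Rsqr. nra.
Qed.

Lemma norm_C_ge (x : C) :
  Rabs (fst x) <= norm (x : C_R_NormedModule) /\ Rabs (snd x) <= norm (x : C_R_NormedModule).
Proof.
destruct x as [a b]. destruct (norm_prod (K := R_AbsRing) (U := R_NormedModule) (V := R_NormedModule) a b) as [H _].
split; apply Rle_trans with (2 := H); [apply Rmax_l | apply Rmax_r].
Qed.

Lemma filterdiff_C (F : (R -> Prop) -> Prop) {FF : Filter F} (f : R -> C) (l : C) :
  filterdiff (V := C_R_NormedModule) f F (fun h => scal h (l : C_R_NormedModule)) <->
  filterdiff (fun y => Re (f y)) F (fun h => scal h (Re l)) /\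
  filterdiff (fun y => Im (f y)) F (fun h => scal h (Im l)).
Proof.
split.
- intros [_ H]. split; (split; [exact (is_linear_scal_l (K := R_AbsRing) (V := R_NormedModule) _)|]); intros x Hx eps;
  generalize (H x Hx eps); apply filter_imp; intros y Hy;
  apply Rle_trans with (2 := Hy).
  + exact (proj1 (norm_C_ge (@minus C_R_NormedModule (minus (f y : C_R_NormedModule) (f x)) (scal (minus y x) (l : C_R_NormedModule))))).
  + exact (proj2 (norm_C_ge (@minus C_R_NormedModule (minus (f y : C_R_NormedModule) (f x)) (scal (minus y x) (l : C_R_NormedModule))))).
- intros [[_ H1] [_ H2]]. split; [exact (is_linear_scal_l (K := R_AbsRing) (V := C_R_NormedModule) _)|].
  intros x Hx eps.
  assert (He : 0 < eps / 2) by (destruct eps; simpl; lra).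
  generalize (filter_and _ _ (H1 x Hx (mkposreal _ He)) (H2 x Hx (mkposreal _ He))).
  apply filter_imp. intros y [K1 K2].
  apply Rle_trans with (1 := norm_C_le (@minus C_R_NormedModule (minus (f y : C_R_NormedModule) (f x)) (scal (minus y x) (l : C_R_NormedModule)))).
  replace (pos eps) with (eps / 2 + eps / 2) by field. rewrite Rmult_plus_distr_r.
  apply Rplus_le_compat; [exact K1 | exact K2].
Qed.

Lemma is_derive_C (f : R -> C) (x : R) (l : C) :
  is_derive (V := C_R_NormedModule) f x l <->
  is_derive (fun y => Re (f y)) x (Re l) /\ is_derive (fun y => Im (f y)) x (Im l).
Proof. apply (filterdiff_C (locally x) f l). Qed.

Lemma filterlim_C {T} (F : (T -> Prop) -> Prop) {FF : Filter F} (f : T -> C) (l : C) :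
  filterlim f F (locally l) <->
  filterlim (fun y => Re (f y)) F (locally (Re l)) /\ filterlim (fun y => Im (f y)) F (locally (Im l)).
Proof.
split.
- intros H. split; apply filterlim_locally; intros eps;
  generalize (proj1 (filterlim_locally f l) H eps); apply filter_imp; intros y [H1 H2]; assumption.
- intros [H1 H2]. apply filterlim_locally. intros eps.
  generalize (filter_and _ _ (proj1 (filterlim_locally _ _) H1 eps) (proj1 (filterlim_locally _ _) H2 eps)).
  apply filter_imp. intros y [K1 K2]; now split.
Qed.

(** * The function [E] and the kernels [K0] and [K1] *)

Lemma iM_pair M : iM M = (0, M).
Proof. unfold iM, Ci, RtoC, Cmult; simpl. f_equal; ring. Qed.

Lemma rcpow_iM X M : rcpow X (iM M) = (cos (M * ln X), sin (M * ln X)).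
Proof. rewrite iM_pair. unfold rcpow, Re, Im; simpl. rewrite Rmult_0_l, exp_0. f_equal; ring. Qed.

Lemma rcpow_minus_iM X M : rcpow X (- iM M) = (cos (M * ln X), - sin (M * ln X)).
Proof.
rewrite iM_pair. unfold rcpow, Re, Im; simpl. rewrite Ropp_0, Rmult_0_l, exp_0, Ropp_mult_distr_l_reverse.
rewrite cos_neg, sin_neg. f_equal; ring.
Qed.

(** The phases of [X] cancel, so only [(1 + w)^(- i M)] is left. *)
Lemma rcpow_ratio X w M : 0 < X -> -1 < w ->
  (rcpow X (iM M) * rcpow (X * (1 + w)) (- iM M))%C
  = (cos (M * ln (1 + w)), - sin (M * ln (1 + w))).
Proof.
intros HX Hw. rewrite rcpow_iM, rcpow_minus_iM, ln_mult by lra.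
rewrite Rmult_plus_distr_l, cos_plus, sin_plus.
generalize (sin2_cos2 (M * ln X)). unfold Rsqr.
generalize (cos (M * ln X)) (sin (M * ln X)) (cos (M * ln (1 + w))) (sin (M * ln (1 + w))).
intros c s c1 s1 H. unfold Cmult; simpl.
f_equal.
- transitivity ((s * s + c * c) * c1); [ring | rewrite H; ring].
- transitivity (- (s * s + c * c) * s1); [ring | rewrite H; ring].
Qed.

Lemma rcpow_half X M :
  rcpow X (- half - iM M) = (RtoC (exp (- / 2 * ln X)) * rcpow X (- iM M))%C.
Proof.
rewrite rcpow_minus_iM, minus_half_minus_iM. unfold rcpow, Re, Im, RtoC, Cmult; simpl.
rewrite !Ropp_mult_distr_l_reverse, cos_neg, sin_neg.
replace (-1 / 2 * ln X) with (- (/ 2 * ln X)) by field.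
f_equal; ring.
Qed.

(** The value of [(4 exp (- y))^(- 1/2)]; this is the origin of the prefactor of [kernel]. *)
Lemma exp_ln_4 y : exp (- / 2 * ln (4 * exp (- y))) = / 2 * exp (y / 2).
Proof.
rewrite ln_mult, ln_exp; [|lra | apply exp_pos].
replace (- / 2 * (ln 4 + - y)) with (- (/ 2 * ln 4) + y / 2) by field.
rewrite exp_plus, exp_Ropp. f_equal. f_equal.
replace 4 with (2 * 2) by ring. rewrite ln_mult by lra.
replace (/ 2 * (ln 2 + ln 2)) with (ln 2) by field. apply exp_ln; lra.
Qed.

Definition unit_power (M w : R) : C := (cos (M * ln (1 + w)), - sin (M * ln (1 + w))).

Lemma twist_pair M P Q w :
  (twist M P Q w, twist M Q (fun x => - P x) w)
  = (RtoC (exp (- / 2 * ln (1 + w))) * unit_power M w * (P (w / (1 + w))%R, Q (w / (1 + w))%R))%C.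
Proof. unfold twist, unit_power, RtoC, Cmult; simpl. f_equal; ring. Qed.

(** With [X = 4 * exp (- b - t)] the two quadratic expressions in [E] are [X * w] and [X * (1 + w)].
    The hypothesis means that the second is positive; it is an open condition that holds on the
    closed light cone, so the identity can be differentiated in [b] even at the boundary. *)
Lemma E_kernel M z t b : -1 < warg t b z ->
  E M z t 0 b = (kernel (hre M) t b z, kernel (him M) t b z).
Proof.
intros Hw. unfold E, kernel. rewrite Rminus_0_r.
set (X := 4 * exp (- b - t)). set (w := warg t b z) in *.
assert (HX : 0 < X) by (unfold X; generalize (exp_pos (- b - t)); lra).
assert (HN : (exp (- b) - exp (- t)) ^ 2 - z ^ 2 = X * w).
{ unfold w. rewrite warg_alt. fold X. field. unfold X in *. lra. }
assert (HD : (exp (- t) + exp (- b)) ^ 2 - z ^ 2 = X * (1 + w)).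
{ rewrite Rmult_plus_distr_l, <- HN. unfold X, Rminus. rewrite exp_plus. ring. }
rewrite HN, HD.
replace (X * w / (X * (1 + w))) with (w / (1 + w)) by (field; lra).
change (hypF (half + iM M) (half + iM M) 1 (w / (1 + w))) with (Fre M (w / (1 + w)), Fim M (w / (1 + w))).
rewrite rcpow_half.
transitivity (RtoC (exp (- / 2 * ln (X * (1 + w)))) * (rcpow X (iM M) * rcpow (X * (1 + w)) (- iM M))
  * (Fre M (w / (1 + w)), Fim M (w / (1 + w))))%C; [ring|].
rewrite rcpow_ratio by assumption. fold (unit_power M w).
rewrite ln_mult, Rmult_plus_distr_l, exp_plus, RtoC_mult by lra.
transitivity (RtoC (exp (- / 2 * ln X)) * (hre M w, him M w))%C.
- unfold hre, him. rewrite twist_pair. ring.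
- unfold X. replace (- b - t) with (- (b + t)) by ring. rewrite exp_ln_4.
  unfold RtoC, Cmult; simpl. f_equal; ring.
Qed.

Lemma warg_initial_nonneg z t : Rabs z <= 1 - exp (- t) -> 0 <= warg t 0 z.
Proof.
intros H. apply warg_nonneg. rewrite Rabs_minus_sym, Ropp_0, exp_0.
apply Rle_trans with (1 := H). apply Rle_abs.
Qed.

Lemma him_vanish M w : 0 <= w -> him M w = 0 /\ him1 M w = 0.
Proof.
intros Hw. apply (twist_vanish M _ _ (Fim2 M) _ _ (fun x => - Fre2 M x)); [|apply Fim_0 | exact Hw].
apply hyp_system_rotate, hyp_system_F.
Qed.

(** For [z] at the end of the interval, [warg] becomes negative on one side of [b = 0]. Hence the
    derivative is taken with [hre] and [him] themselves, and [profile] and the vanishing of [him]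
    and [him1] enter only at [b = 0], where [warg] is nonnegative. *)
Lemma is_derive_E M z t : Rabs z <= 1 - exp (- t) ->
  is_derive (V := C_R_NormedModule) (fun b => E M z t 0 b) 0
    (RtoC (kernel_s (profile M) (profile1 M) t 0 z)).
Proof.
intros Hz. assert (Hw := warg_initial_nonneg z t Hz).
assert (S := hyp_system_F M). assert (S' := hyp_system_rotate _ _ _ _ _ _ _ S).
assert (HL : locally 0 (fun b => -1 < warg t b z)).
{ apply (continuous_derive _ _ _ (is_derive_warg_s t 0 z) (fun w => -1 < w)).
  assert (H1 : 0 < 1 + warg t 0 z) by lra. exists (mkposreal _ H1). intros y Hy.
  assert (Hy' : Rabs (y - warg t 0 z) < 1 + warg t 0 z) by exact Hy. apply Rabs_def2 in Hy'. lra. }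
apply is_derive_C. split.
- apply (is_derive_ext_loc (fun b => kernel (hre M) t b z)).
  + revert HL. apply filter_imp. intros b Hb. now rewrite E_kernel.
  + unfold Re; simpl. unfold kernel_s. destruct (profile_nonneg M _ Hw) as (-> & -> & _).
    apply (is_derive_kernel_s (hre M) (hre1 M)).
    apply (is_derive_twist_0 M _ _ (Fre2 M) _ _ (Fim2 M)); [exact S | lra].
- apply (is_derive_ext_loc (fun b => kernel (him M) t b z)).
  + revert HL. apply filter_imp. intros b Hb. now rewrite E_kernel.
  + evar_last. apply (is_derive_kernel_s (him M) (him1 M)).
    * apply (is_derive_twist_0 M _ _ (Fim2 M) _ _ (fun x => - Fre2 M x)); [exact S' | lra].
    * unfold kernel_s. destruct (him_vanish M _ Hw) as [-> ->]. unfold Im; simpl. field.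
Qed.

Lemma K0_kernel M z t : Rabs z <= 1 - exp (- t) ->
  K0 M z t = RtoC (- kernel_s (profile M) (profile1 M) t 0 z).
Proof.
intros Hz. destruct (proj1 (is_derive_C _ _ _) (is_derive_E M z t Hz)) as [H1 H2].
assert (R1 : Derive (fun y : R => Re (E M z t 0 y)) 0 = _) by exact (is_derive_unique _ _ _ H1).
assert (R2 : Derive (fun y : R => Im (E M z t 0 y)) 0 = _) by exact (is_derive_unique _ _ _ H2).
unfold K0, CDerive. rewrite R1, R2.
unfold RtoC, Copp, Re, Im; simpl. f_equal. ring.
Qed.

Lemma K1_kernel M z t : Rabs z <= 1 - exp (- t) ->
  K1 M z t = RtoC (kernel (profile M) t 0 z).
Proof.
intros Hz. assert (Hw := warg_initial_nonneg z t Hz).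
unfold K1. rewrite E_kernel by lra. unfold kernel.
destruct (profile_nonneg M _ Hw) as (-> & _). destruct (him_vanish M _ Hw) as [-> _].
unfold RtoC. f_equal. ring.
Qed.

Lemma K1_eq_formula M z t : K1 M z t = K1_formula M z t.
Proof.
unfold K1, K1_formula, E, zeta.
rewrite Ropp_0, exp_0, Rminus_0_r. replace (0 - t) with (- t) by ring.
replace (exp (- t) + 1) with (1 + exp (- t)) by ring. reflexivity.
Qed.

(** [K0] involves [F] and [F'], and the contiguity relation trades [F'] for [F(a - 1, a; 1; .)]. Its
    coefficient [x (1 - x)] of [F'] is proportional to [N], whence the denominator of the formula
    and the strict inequality on [z]. *)
Lemma K0_eq_formula M z t : 0 < t -> 0 <= z < 1 - exp (- t) -> K0 M z t = K0_formula M z t.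
Proof.
intros Ht Hz.
assert (Hz' : Rabs z <= 1 - exp (- t)) by (rewrite Rabs_pos_eq; lra).
assert (Hw := warg_initial_nonneg z t Hz').
rewrite (K0_kernel M z t Hz'). unfold kernel_s.
destruct (profile_nonneg M _ Hw) as (-> & -> & _).
destruct (him_vanish M _ Hw) as [I0 I1].
rewrite Rplus_0_l.
set (w := warg t 0 z) in *. set (ws := warg_s t 0 z).
set (y := exp (- t)) in *.
assert (Hy : 0 < y) by apply exp_pos.
set (N := (1 - y) ^ 2 - z ^ 2). set (D := (y + 1) ^ 2 - z ^ 2).
assert (HN : 0 < N) by (unfold N; nra).
assert (HD : 0 < D) by (unfold D; nra).
assert (Nw : N = 4 * y * w).
{ unfold w. rewrite warg_alt, Ropp_0, exp_0. fold y. replace (0 - t) with (- t) by ring. fold y.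
  unfold N. field. lra. }
assert (Dw : D = 4 * y * (1 + w)).
{ rewrite Rmult_plus_distr_l, <- Nw. unfold D, N. ring. }
assert (Hx : w / (1 + w) = N / D) by (rewrite Nw, Dw; field; lra).
assert (Hws : ws = (y ^ 2 - 1 - z ^ 2) / (4 * y)).
{ unfold ws, warg_s. replace (0 - t) with (- t) by ring. rewrite Rminus_0_r, Rplus_0_l.
  replace (exp t) with (/ y) by (unfold y; rewrite exp_Ropp, Rinv_inv; reflexivity).
  fold y. field. lra. }
(* As [D = 4 * y * (1 + w)], the inverse square root in the formula is the exponential prefactor of
   [kernel] times the modulus of [(1 + w)^(- a)]. *)
assert (HsD : / sqrt D = / 2 * exp (t / 2) * exp (- / 2 * ln (1 + w))).
{ rewrite <- exp_ln_4. fold y. rewrite <- exp_plus, <- Rmult_plus_distr_l, <- ln_mult, <- Dw by lra.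
  rewrite <- Rpower_sqrt by exact HD. unfold Rpower. rewrite <- exp_Ropp. f_equal. ring. }
unfold K0_formula. fold y. unfold zeta. fold y.
replace (1 + y) with (y + 1) by ring.
replace (exp (- 2 * t)) with (y ^ 2) by (unfold y; simpl; rewrite Rmult_1_r, <- exp_plus; f_equal; ring).
fold N D. rewrite <- Hx.
rewrite Dw at 1. rewrite rcpow_ratio by lra. fold (unit_power M w).
assert (Hxl : Rabs (w / (1 + w)) < 1) by (apply ratio_lt_1; lra).
destruct (hyp_contiguity M _ Hxl) as [G1 G2].
change (hypF (half + iM M) (half + iM M) 1 (w / (1 + w))) with (Fre M (w / (1 + w)), Fim M (w / (1 + w))).
change (hypF (- half + iM M) (half + iM M) 1 (w / (1 + w)))
  with (PSeries (cre' M) (w / (1 + w)), PSeries (cim' M) (w / (1 + w))).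
set (x := w / (1 + w)) in *.
set (U := unit_power M w).
pose (g1 := (tderiv M (Fre M) (Fim M) (Fre1 M) x, tderiv (- M) (Fim M) (Fre M) (Fim1 M) x) : C).
(* The bracket of the formula is [- N] times [F / 2 + ws * g1], where [g1] is what differentiation
   of the twisted function makes of [F]; the factor [N] then cancels the denominator. *)
assert (HB : ((RtoC (y - 1) - iM M * RtoC (y ^ 2 - 1 - z ^ 2)) * (Fre M x, Fim M x)
  + RtoC (1 - y ^ 2 + z ^ 2) * (half - iM M) * (PSeries (cre' M) x, PSeries (cim' M) x)
  = - RtoC N * (RtoC (/ 2) * (Fre M x, Fim M x) + RtoC ws * g1))%C).
{ transitivity ((RtoC (y - 1) - iM M * RtoC (y ^ 2 - 1 - z ^ 2)) * (Fre M x, Fim M x)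
    + RtoC (1 - y ^ 2 + z ^ 2) * ((half - iM M) * (PSeries (cre' M) x, PSeries (cim' M) x)))%C; [ring|].
  replace ((half - iM M) * (PSeries (cre' M) x, PSeries (cim' M) x))%C
   with ((1 / 2 * PSeries (cre' M) x + M * PSeries (cim' M) x,
          1 / 2 * PSeries (cim' M) x - M * PSeries (cre' M) x) : C).
  2: { rewrite iM_pair. unfold half, RtoC, Cminus, Copp, Cplus, Cmult; simpl. f_equal; ring. }
  rewrite G1, G2. unfold g1, tderiv. rewrite iM_pair, Hws.
  assert (Hx1 : x = N / D) by (exact Hx).
  rewrite Hx1. clear - Hy HN HD. unfold RtoC, Cminus, Copp, Cplus, Cmult; simpl.
  generalize (Fre M (N / D)) (Fim M (N / D)) (Fre1 M (N / D)) (Fim1 M (N / D)). intros p q p1 q1.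
  revert HN HD. unfold N, D. intros HN HD. f_equal; field; simpl in *; lra. }
rewrite HB.
transitivity (RtoC (- (/ 2 * exp (t / 2))) *
  (RtoC (/ 2) * (hre M w, him M w) + RtoC ws * (hre1 M w, him1 M w)))%C.
{ rewrite I0, I1. unfold RtoC, Cmult, Cplus; simpl. f_equal; field. }
replace (hre M w, him M w) with (RtoC (exp (- / 2 * ln (1 + w))) * U * (Fre M x, Fim M x))%C
  by (unfold hre, him; rewrite twist_pair; reflexivity).
replace (hre1 M w, him1 M w) with (RtoC (exp (- / 2 * ln (1 + w))) * U * g1)%C.
2: { transitivity (twist M (tderiv M (Fre M) (Fim M) (Fre1 M)) (tderiv (- M) (Fim M) (Fre M) (Fim1 M)) w,
       twist M (tderiv (- M) (Fim M) (Fre M) (Fim1 M)) (fun x => - tderiv M (Fre M) (Fim M) (Fre1 M) x) w).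
     - rewrite twist_pair. reflexivity.
     - f_equal. unfold him1, twist1, twist, tderiv. ring. }
replace (RtoC (- (/ 2 * exp (t / 2)))) with (- (RtoC (/ sqrt D) * / RtoC (exp (- / 2 * ln (1 + w)))))%C.
2: { rewrite HsD, <- RtoC_inv, <- RtoC_mult, <- RtoC_opp by (apply Rgt_not_eq, exp_pos).
     f_equal. field. apply Rgt_not_eq, exp_pos. }
assert (NZ1 : RtoC (exp (- / 2 * ln (1 + w))) <> 0%C) by apply RtoC_neq_0, Rgt_not_eq, exp_pos.
assert (NZ2 : RtoC N <> 0%C) by (apply RtoC_neq_0; lra).
assert (HsD0 : sqrt D <> 0) by (apply Rgt_not_eq, sqrt_lt_R0; exact HD).
assert (NZ3 : RtoC (sqrt D) <> 0%C) by (now apply RtoC_neq_0).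
rewrite RtoC_inv, RtoC_mult by exact HsD0. field. auto.
Qed.

(** To the left of the endpoint the formula equals [- kernel_s], which is continuous across it, so
    the indeterminate quotient needs no expansion. *)
Lemma K0_formula_limit M t : 0 < t ->
  filterlim (fun y => K0_formula M y t) (at_left (1 - exp (- t))) (locally (K0 M (1 - exp (- t)) t)).
Proof.
intros Ht. set (r := 1 - exp (- t)).
assert (Hr : 0 < r).
{ unfold r. assert (H : exp (- t) < exp 0) by (apply exp_increasing; lra). rewrite exp_0 in H. lra. }
apply (filterlim_ext_loc (fun y => RtoC (- kernel_s (profile M) (profile1 M) t 0 y))).
- exists (mkposreal _ Hr). intros y Hy Hlt.
  assert (Hy' : Rabs (y - r) < r) by exact Hy. apply Rabs_def2 in Hy'.
  rewrite <- K0_kernel, K0_eq_formula; auto; fold r; [lra|].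
  rewrite Rabs_pos_eq; lra.
- rewrite K0_kernel by (fold r; rewrite Rabs_pos_eq; lra).
  apply (filterlim_filter_le_1 (F := locally r)); [apply filter_le_within|].
  refine (proj2 (filterlim_C (FF := filter_filter (F := locally r)) (locally r) _ _) (conj _ _)); [|exact (filterlim_const (U := R_UniformSpace) (F := locally r) 0)].
  destruct (radial_profile_hyp M) as (H0 & H1 & _).
  apply (continuous_Ropp (fun y => kernel_s (profile M) (profile1 M) t 0 y)).
  apply (continuous2_snd (kernel_s (profile M) (profile1 M) t)).
  apply continuous2_kernel_s; intros w; [apply (continuous_derive _ _ _ (H0 w)) | apply (continuous_derive _ _ _ (H1 w))].
Qed.

(** * Complex solutions by components, and the representation formula *)

Lemma continuous_halfplane_C (g : R -> R -> C) :
  continuous_halfplane g <->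
  continuous_on_halfplane (fun x t => Re (g x t)) /\ continuous_on_halfplane (fun x t => Im (g x t)).
Proof.
assert (FF : forall q : R * R, Filter (within (fun p : R * R => 0 <= snd p) (locally q))).
{ intros q. apply within_filter. apply filter_filter. }
split.
- intros H. split; intros q Hq;
    destruct (proj1 (filterlim_C (FF := FF q) _ (fun p => g (fst p) (snd p)) _) (H q Hq)); assumption.
- intros [H1 H2] q Hq.
  exact (proj2 (filterlim_C (FF := FF q) _ (fun p => g (fst p) (snd p)) _) (conj (H1 q Hq) (H2 q Hq))).
Qed.

Lemma right_derive_C (f : R -> C) (t : R) (l : C) :
  filterdiff (V := C_R_NormedModule) f (within (fun s => 0 <= s) (locally t))
    (fun h => scal h (l : C_R_NormedModule)) <->
  right_derive (fun s => Re (f s)) t (Re l) /\ right_derive (fun s => Im (f s)) t (Im l).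
Proof. apply filterdiff_C. apply within_filter, filter_filter. Qed.

Lemma solution_components M phi0 phi1 u :
  solution M phi0 phi1 u ->
  exists ux ut uxx utt,
    real_solution M (fun x t => Re (u x t)) (fun x t => Re (ux x t)) (fun x t => Re (ut x t))
      (fun x t => Re (uxx x t)) (fun x t => Re (utt x t)) /\
    real_solution M (fun x t => Im (u x t)) (fun x t => Im (ux x t)) (fun x t => Im (ut x t))
      (fun x t => Im (uxx x t)) (fun x t => Im (utt x t)) /\
    (forall x, u x 0 = phi0 x) /\ (forall x, ut x 0 = phi1 x).
Proof.
intros (ux & ut & uxx & uxt & utx & utt & (C0 & C1 & C2 & D0) & (_ & C3 & _ & D1) & (_ & _ & C4 & D2) & E & I0 & I1).
exists ux, ut, uxx, utt.
apply continuous_halfplane_C in C0, C1, C2, C3, C4.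
destruct C0 as [C0 C0'], C1 as [C1 C1'], C2 as [C2 C2'], C3 as [C3 C3'], C4 as [C4 C4'].
split; [|split; [|now split]].
- repeat (split; [assumption|]). intros x t Ht.
  destruct (D0 x t Ht) as [A0 B0]. destruct (D1 x t Ht) as [A1 _]. destruct (D2 x t Ht) as [_ B2].
  apply is_derive_C in A0, A1. apply right_derive_C in B0, B2.
  refine (conj (proj1 A0) (conj (proj1 A1) (conj (proj1 B0) (conj (proj1 B2) _)))).
  assert (K := f_equal Re (E x t Ht)). revert K.
  cbv [Cplus Cminus Copp Cmult RtoC Re Im fst snd]. destruct (u x t), (utt x t), (uxx x t). lra.
- repeat (split; [assumption|]). intros x t Ht.
  destruct (D0 x t Ht) as [A0 B0]. destruct (D1 x t Ht) as [A1 _]. destruct (D2 x t Ht) as [_ B2].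
  apply is_derive_C in A0, A1. apply right_derive_C in B0, B2.
  refine (conj (proj2 A0) (conj (proj2 A1) (conj (proj2 B0) (conj (proj2 B2) _)))).
  assert (K := f_equal Im (E x t Ht)). revert K.
  cbv [Cplus Cminus Copp Cmult RtoC Re Im fst snd]. destruct (u x t), (utt x t), (uxx x t). lra.
Qed.

Lemma smooth_Re f : smooth f -> smooth_seq (Derive_n (fun y => Re (f y))).
Proof. intros H n x. apply Derive_correct. apply (H (S n) x). Qed.

Lemma smooth_Im f : smooth f -> smooth_seq (Derive_n (fun y => Im (f y))).
Proof. intros H n x. apply Derive_correct. apply (H (S n) x). Qed.

Lemma solution_exists M phi0 phi1 : smooth phi0 -> smooth phi1 ->
  exists u, solution M phi0 phi1 u.
Proof.
intros H0 H1. assert (Hh := radial_profile_hyp M).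
destruct (real_existence M _ _ _ _ _ Hh (smooth_Re _ H0) (smooth_Re _ H1))
  as (u & ux & ut & uxx & uxt & utt & (C0 & C1 & C2 & C3 & C4 & D) & C5 & D' & I0 & I1).
destruct (real_existence M _ _ _ _ _ Hh (smooth_Im _ H0) (smooth_Im _ H1))
  as (v & vx & vt & vxx & vxt & vtt & (K0 & K1 & K2 & K3 & K4 & E) & K5 & E' & J0 & J1).
exists (fun x t => (u x t, v x t)).
(* One function serves as both mixed derivatives. *)
exists (fun x t => (ux x t, vx x t)), (fun x t => (ut x t, vt x t)), (fun x t => (uxx x t, vxx x t)),
  (fun x t => (uxt x t, vxt x t)), (fun x t => (uxt x t, vxt x t)), (fun x t => (utt x t, vtt x t)).
assert (CC : forall a b, continuous_on_halfplane a -> continuous_on_halfplane b ->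
  continuous_halfplane (fun x t => (a x t, b x t))).
{ intros a b Ha Hb. apply continuous_halfplane_C. now split. }
assert (DC : forall (a b : R -> R) x la lb, is_derive a x la -> is_derive b x lb ->
  is_derive (V := C_R_NormedModule) (fun y => (a y, b y)) x (la, lb)).
{ intros a b x la lb Ha Hb. apply (is_derive_C (fun y => (a y, b y)) x (la, lb)). now split. }
assert (RC : forall (a b : R -> R) t la lb, right_derive a t la -> right_derive b t lb ->
  filterdiff (V := C_R_NormedModule) (fun y => (a y, b y)) (within (fun s => 0 <= s) (locally t))
    (fun h => scal h ((la, lb) : C_R_NormedModule))).
{ intros a b x la lb Ha Hb. apply (right_derive_C (fun y => (a y, b y)) x (la, lb)). now split. }
refine (conj (conj _ (conj _ (conj _ _))) (conj (conj _ (conj _ (conj _ _))) (conj (conj _ (conj _ (conj _ _))) (conj _ (conj _ _)))));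
  try (apply CC; assumption).
- intros x t Ht. destruct (D x t Ht) as (A1 & A2 & A3 & A4 & _), (E x t Ht) as (B1 & B2 & B3 & B4 & _).
  split; [now apply DC | now apply RC].
- intros x t Ht. destruct (D x t Ht) as (A1 & A2 & A3 & A4 & _), (E x t Ht) as (B1 & B2 & B3 & B4 & _).
  split; [now apply DC | now apply RC; [apply D' | apply E']].
- intros x t Ht. destruct (D x t Ht) as (A1 & A2 & A3 & A4 & _), (E x t Ht) as (B1 & B2 & B3 & B4 & _).
  split; [now apply DC; [apply D' | apply E'] | now apply RC].
- intros x t Ht. destruct (D x t Ht) as (_ & _ & _ & _ & A), (E x t Ht) as (_ & _ & _ & _ & B).
  rewrite A, B. unfold RtoC, Cplus, Cminus, Copp, Cmult; simpl. f_equal; ring.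
- intros x. rewrite I0, J0. simpl. now destruct (phi0 x).
- intros x. rewrite I1, J1. simpl. now destruct (phi1 x).
Qed.

(** A kernel that is real and even on the cone turns the integral over [[0, r]] of the sum of the
    two shifts into componentwise integrals over [[- r, r]], the form in which the real
    representation is proved. *)
Lemma is_RInt_integrand (phi : R -> C) (K : R -> R -> C) (k : R -> R) (x t : R) :
  0 < t -> (forall y, continuous (fun y => Re (phi y)) y) -> (forall y, continuous (fun y => Im (phi y)) y) ->
  (forall z, continuous k z) -> (forall z, k (- z) = k z) ->
  (forall z, Rabs z <= 1 - exp (- t) -> K z t = RtoC (k z)) ->
  is_RInt (V := C_R_NormedModule) (integrand phi K x t) 0 (1 - exp (- t))
    (RInt (fun z => Re (phi (x + z)) * k z) (- (1 - exp (- t))) (1 - exp (- t)),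
     RInt (fun z => Im (phi (x + z)) * k z) (- (1 - exp (- t))) (1 - exp (- t))).
Proof.
intros Ht Cr Ci Ck Hk HK. set (r := 1 - exp (- t)).
assert (Hr : 0 < r).
{ unfold r. assert (H : exp (- t) < exp 0) by (apply exp_increasing; lra). rewrite exp_0 in H. lra. }
assert (S : forall g : R -> R, (forall y, continuous g y) ->
  is_RInt (fun z => (g (x - z) + g (x + z)) * k z) 0 r (RInt (fun z => g (x + z) * k z) (- r) r)).
{ intros g Cg.
  assert (C1 : forall z, continuous (fun z => g (x + z) * k z) z).
  { intros z. continuous_R; [|apply Ck]. apply (continuous_comp_R g (fun z => x + z)); [continuous_R | apply Cg]. }
  assert (C2 : forall z, continuous (fun z => g (x + z) * k z + g (x + - z) * k (- z)) z).
  { intros z. continuous_R; [| | | apply (continuous_comp_R k (fun z => - z)); [continuous_R | apply Ck]].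
    - apply (continuous_comp_R g (fun z => x + z)); [continuous_R | apply Cg].
    - apply Ck.
    - apply (continuous_comp_R g (fun z => x + - z)); [continuous_R | apply Cg]. }
  rewrite (RInt_symmetric (fun z => g (x + z) * k z) r C1).
  apply (is_RInt_ext (fun z => g (x + z) * k z + g (x + - z) * k (- z))).
  { intros z _. rewrite Hk. unfold Rminus. simpl. ring. }
  apply (RInt_correct (V := R_CompleteNormedModule)). now apply ex_RInt_continuous_R. }
apply (is_RInt_ext (V := C_R_NormedModule)
  (fun z => ((Re (phi (x - z)) + Re (phi (x + z))) * k z, (Im (phi (x - z)) + Im (phi (x + z))) * k z) : C)).
{ intros z Hz. rewrite Rmin_left, Rmax_right in Hz by lra.
  unfold integrand. rewrite HK by (fold r; rewrite Rabs_pos_eq; lra).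
  unfold Re, Im, RtoC, Cmult, Cplus; simpl. f_equal; ring. }
apply (is_RInt_fct_extend_pair (U := R_NormedModule) (V := R_NormedModule)).
- apply (S (fun y => Re (phi y)) Cr).
- apply (S (fun y => Im (phi y)) Ci).
Qed.

Lemma RInt_data_split (a b k l : R -> R) (r : R) :
  (forall z, continuous a z) -> (forall z, continuous b z) ->
  (forall z, continuous k z) -> (forall z, continuous l z) ->
  RInt (fun z => a z * k z - b z * l z) (- r) r
  = RInt (fun z => b z * - l z) (- r) r + RInt (fun z => a z * k z) (- r) r.
Proof.
intros Ca Cb Ck Cl.
rewrite <- (RInt_plus (V := R_CompleteNormedModule) (fun z => b z * - l z) (fun z => a z * k z)).
- apply RInt_ext. intros z _. unfold plus; simpl. ring.
- apply ex_RInt_continuous_R. intros z. specialize (Cb z); specialize (Cl z). continuous_R.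
- apply ex_RInt_continuous_R. intros z. specialize (Ca z); specialize (Ck z). continuous_R.
Qed.

Theorem theorem0p4 :
  forall (M : R) (phi0 phi1 : R -> C),
    0 <= M -> test_function phi0 -> test_function phi1 ->
    (exists u : R -> R -> C, solution M phi0 phi1 u) /\
    (forall u : R -> R -> C, solution M phi0 phi1 u ->
     forall x t : R, 0 < t ->
       ex_CInt (integrand phi0 (K0 M) x t) 0 (1 - exp (- t)) /\
       ex_CInt (integrand phi1 (K1 M) x t) 0 (1 - exp (- t)) /\
       u x t =
         (RtoC (/ 2 * exp (t / 2))
            * (phi0 (x + 1 - exp (- t))%R + phi0 (x - 1 + exp (- t))%R)
          + CInt (integrand phi0 (K0 M) x t) 0 (1 - exp (- t))
          + CInt (integrand phi1 (K1 M) x t) 0 (1 - exp (- t)))%C) /\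
    (forall z t : R, 0 < t -> 0 <= z <= 1 - exp (- t) ->
       is_derive (V := C_R_NormedModule) (fun b => E M z t 0 b) 0 (- K0 M z t)%C /\
       (z < 1 - exp (- t) -> K0 M z t = K0_formula M z t) /\
       (z = 1 - exp (- t) ->
          filterlim (fun y => K0_formula M y t) (at_left z) (locally (K0 M z t))) /\
       K1 M z t = K1_formula M z t).
Proof.
intros M phi0 phi1 _ [S0 _] [S1 _].
assert (Hh := radial_profile_hyp M).
assert (Hh' := Hh). destruct Hh' as (Hh0 & Hh1 & _).
assert (Ch0 : forall w, continuous (profile M) w) by (intros w; apply (continuous_derive _ _ _ (Hh0 w))).
assert (Ch1 : forall w, continuous (profile1 M) w) by (intros w; apply (continuous_derive _ _ _ (Hh1 w))).
split; [now apply solution_exists|]. split.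
- intros u Hu x t Ht. set (r := 1 - exp (- t)).
  assert (CRe : forall f, smooth f -> forall y, continuous (fun y => Re (f y)) y).
  { intros f Hf y. apply (continuous_derive _ _ _ (smooth_Re f Hf O y)). }
  assert (CIm : forall f, smooth f -> forall y, continuous (fun y => Im (f y)) y).
  { intros f Hf y. apply (continuous_derive _ _ _ (smooth_Im f Hf O y)). }
  assert (Cshift : forall g : R -> R, (forall y, continuous g y) -> forall z, continuous (fun z => g (x + z)) z).
  { intros g Hg z. apply (continuous_comp_R g (fun z => x + z)); [continuous_R | apply Hg]. }
  assert (Ck : forall z, continuous (kernel (profile M) t 0) z).
  { apply continuous2_snd. now apply continuous2_kernel. }
  assert (Cks : forall z, continuous (kernel_s (profile M) (profile1 M) t 0) z).
  { apply continuous2_snd. now apply continuous2_kernel_s. }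
  assert (A0 := is_RInt_integrand phi0 (K0 M) (fun z => - kernel_s (profile M) (profile1 M) t 0 z) x t Ht
    (CRe _ S0) (CIm _ S0) (fun z => continuous_Ropp _ z (Cks z))
    (fun z => f_equal Ropp (kernel_s_even _ _ _ _ z)) (fun z => K0_kernel M z t)).
  assert (A1 := is_RInt_integrand phi1 (K1 M) (kernel (profile M) t 0) x t Ht
    (CRe _ S1) (CIm _ S1) Ck (kernel_even _ _ _) (fun z => K1_kernel M z t)).
  fold r in A0, A1.
  split; [eexists; exact A0|]. split; [eexists; exact A1|].
  unfold CInt.
  rewrite (is_RInt_unique (V := C_R_CompleteNormedModule) _ _ _ _ A0).
  rewrite (is_RInt_unique (V := C_R_CompleteNormedModule) _ _ _ _ A1).
  destruct (solution_components M phi0 phi1 u Hu) as (ux & ut & uxx & utt & Rre & Rim & I0 & I1).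
  (* The same real kernel serves both components of [u]. *)
  assert (Vre := real_representation M _ _ _ _ _ _ _ _ x t Hh Rre Ht). cbv zeta in Vre.
  assert (Vim := real_representation M _ _ _ _ _ _ _ _ x t Hh Rim Ht). cbv zeta in Vim.
  fold r in Vre, Vim. cbv beta in Vre, Vim. rewrite !I0 in Vre, Vim.
  rewrite (RInt_ext _ (fun z => Re (phi1 (x + z)) * kernel (profile M) t 0 z
    - Re (phi0 (x + z)) * kernel_s (profile M) (profile1 M) t 0 z)) in Vre
    by (intros; now rewrite I0, I1).
  rewrite (RInt_ext _ (fun z => Im (phi1 (x + z)) * kernel (profile M) t 0 z
    - Im (phi0 (x + z)) * kernel_s (profile M) (profile1 M) t 0 z)) in Vim
    by (intros; now rewrite I0, I1).
  rewrite (RInt_data_split (fun z => Re (phi1 (x + z))) (fun z => Re (phi0 (x + z))) _ _ r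
    (Cshift (fun y => Re (phi1 y)) (CRe _ S1)) (Cshift (fun y => Re (phi0 y)) (CRe _ S0)) Ck Cks) in Vre.
  rewrite (RInt_data_split (fun z => Im (phi1 (x + z))) (fun z => Im (phi0 (x + z))) _ _ r
    (Cshift (fun y => Im (phi1 y)) (CIm _ S1)) (Cshift (fun y => Im (phi0 y)) (CIm _ S0)) Ck Cks) in Vim.
  replace (x + 1 - exp (- t)) with (x + r) by (unfold r; ring).
  replace (x - 1 + exp (- t)) with (x - r) by (unfold r; ring).
  rewrite (surjective_pairing (u x t)).
  unfold RtoC, Cmult, Cplus; simpl. f_equal; unfold Re, Im in *; lra.
- intros z t Ht Hz.
  assert (Hz' : Rabs z <= 1 - exp (- t)) by (rewrite Rabs_pos_eq; lra).
  split; [|split; [|split]].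
  + rewrite (K0_kernel M z t Hz').
    replace (- RtoC (- kernel_s (profile M) (profile1 M) t 0 z))%C
      with (RtoC (kernel_s (profile M) (profile1 M) t 0 z)) by (rewrite RtoC_opp; ring).
    now apply is_derive_E.
  + intros Hlt. apply K0_eq_formula; [exact Ht | lra].
  + intros ->. now apply K0_formula_limit.
  + apply K1_eq_formula.
Qed.
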